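(* Let $\{\varphi_r\}_{0<r<1}$ be a family of nonnegative functions on $\mathbb{T}$ such that (i) $\int_{\mathbb{T}}\varphi_r(t)\,dt=1$ for all $0<r<1$; and (ii) for any numbers $\varepsilon>0$ and $0<\tau<1$ there exists $\delta>0$ such that $\int_e\varphi_r(t)\,dt<\varepsilon$ for all $0<r<\tau$ and every measurable set $e\subset\mathbb{T}$ with $|e|<\delta$. Let $\lambda\in C[0,1]$ be a real-valued function satisfying $$\lambda(1)=0,\qquad \limsup_{\delta\to 0}\ \liminf_{r\to 1}\int_{-\delta\lambda(r)}^{\delta\lambda(r)}\varphi_r(t)\,dt=1 .$$ Then there exists a function $B\in L^\infty(\mathbb{T})$, which is the boundary function of a Blaschke product, such that for every $x\in\mathbb{T}$ the limit $$\lim_{r\to 1}\Phi_r\bigl(x+\lambda(r),B\bigr)$$ does not exist.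
   Context: $\mathbb{T}=\mathbb{R}/2\pi\mathbb{Z}$ is equipped with Lebesgue measure $dt$ (total mass $2\pi$), $|e|$ is the Lebesgue measure of $e$, and functions on $\mathbb{T}$ are regarded as $2\pi$-periodic functions on $\mathbb{R}$. For a (complex-valued) $f\in L^\infty(\mathbb{T})$ and $0<r<1$, $\Phi_r(x,f)=\int_{\mathbb{T}}\varphi_r(x-t)f(t)\,dt$. Limits $r\to1$ are taken over $r<1$, and $\delta\to0$ over $\delta>0$. The integral $\int_a^b$ is the usual oriented integral. The boundary function of a Blaschke product $\mathcal{B}(z)$ on the unit disc $\{|z|<1\}$ is the function defined for almost every $x\in\mathbb{T}$ by the radial limit $\lim_{\rho\to1^-}\mathcal{B}(\rho e^{ix})$. *)

(* Defs.v *)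
From mathcomp Require Import all_boot all_order all_algebra.
From mathcomp Require Import all_classical all_reals all_analysis.
From mathcomp Require Import ess_sup_inf.
From mathcomp.real_closed Require Export complex.

Set Implicit Arguments.
Unset Strict Implicit.
Unset Printing Implicit Defensive.
Import Order.TTheory GRing.Theory Num.Theory.
Import numFieldNormedType.Exports.

Local Open Scope classical_set_scope.
Local Open Scope ring_scope.
Local Open Scope complex_scope.

(* Lebesgue measure on the sigma-algebra of all Lebesgue measurable (not only
   Borel) subsets of the line. *)
Notation leb R := (@completed_lebesgue_measure R).
Notation lebType R := (caratheodory_type (@wlength R idfun)^*%mu).

Section Definitions.
Context {R : realType}.

(* The circle R/2piZ is represented by a fundamental domain, and functions on it
   by 2pi-periodic functions on the line. *)
Definition circle : set (lebType R) := [set t : R | 0 <= t < 2 * pi].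

Definition leb_measurable_fun (f : R -> R) :=
  measurable_fun [set: lebType R] (f : lebType R -> R).

Definition cintegral (D : set (lebType R)) (f : R -> R[i]) : R[i] :=
  (\int[leb R]_(t in D) complex.Re (f t)) +i* (\int[leb R]_(t in D) complex.Im (f t)).

Definition oriented_integral (f : R -> R) (a b : R) : R :=
  if a <= b then \int[leb R]_(t in `[a, b]) f t
  else - \int[leb R]_(t in `[b, a]) f t.

(* By periodicity, the essential supremum over the line is the one over the
   circle. *)
Definition Linfty_circle (f : R -> R[i]) : Prop :=
  [/\ periodic f (2 * pi),
      leb_measurable_fun (fun t => complex.Re (f t)),
      leb_measurable_fun (fun t => complex.Im (f t)) &
      (ess_sup (leb R) (fun t : lebType R => (complex.Re `|f t|)%:E) < +oo)%E].

Definition Phi (phi : R -> R) (x : R) (f : R -> R[i]) : R[i] :=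
  cintegral circle (fun t => (phi (x - t))%:C * f t).

Definition blaschke_factor (a z : R[i]) : R[i] :=
  if a == 0 then z else `|a| / a * ((a - z) / (1 - a^* * z)).

(* The zeros, repeated according to multiplicity, are the [a k] with [D k]; the
   index set D may be finite (even empty) or infinite. *)
Definition blaschke_product (b : R[i] -> R[i]) : Prop :=
  exists (D : pred nat) (a : nat -> R[i]),
    [/\ forall k, D k -> `|a k| < 1,
        cvgn (series (fun k => if D k then 1 - complex.Re `|a k| else 0 : R)) &
        forall z : R[i], `|z| < 1 ->
          (fun n => \prod_(0 <= k < n | D k) blaschke_factor (a k) z : R[i]^o)
            @ \oo --> (b z : R[i]^o)].

Definition boundary_function (b : R[i] -> R[i]) (B : R -> R[i]) : Prop :=
  {ae leb R, forall x : lebType R,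
     (b (rho%:C * (cos x +i* sin x)) : R[i]^o) @[rho --> (1 : R)^'-]
       --> (B x : R[i]^o)}.

End Definitions.

(* Main.v *)
Require Import Defs.
From mathcomp Require Import all_boot all_order all_algebra.
From mathcomp Require Import all_classical all_reals all_analysis.
From mathcomp.real_closed Require Import complex.
From mathcomp Require Import measurable_realfun ess_sup_inf ring lra.

Set Implicit Arguments.
Unset Strict Implicit.
Unset Printing Implicit Defensive.
Import Order.TTheory GRing.Theory Num.Theory.
Import numFieldNormedType.Exports.

Local Open Scope classical_set_scope.
Local Open Scope ring_scope.

(* Monotonicity in delta turns the hypothesis on lambda into: for every delta > 0 the
   kernels phi_r concentrate on [- delta lambda(r), delta lambda(r)] as r -> 1.  Hence
   Phi_r(x + lambda(r), f) is an average of f around x + lambda(r) at a scale much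
   smaller than lambda(r), and lambda(r) takes all small positive values.

   Let b_k(z) = (rho_k - w) / (1 - rho_k w) with w = z ^ n_k, a finite Blaschke product
   whose zeros are the n_k-th roots of rho_k.  On the circle b_k is -1 at the n_k-th
   roots of unity and close to 1 off a set of small measure around them.  Within
   distance O(1/n_k) of any x there are points x + lambda(r), x + lambda(r') around
   which b_k is close to -1, resp. 1, at the scale of the kernel, while
   P = b_0 ... b_(k-1) is almost constant.  The exceptional sets of the later factors
   are taken so small that, by the equicontinuity assumption, these factors do not
   matter for the values of r used at stage k.  So for B = prod b_k the functions
   Phi_r(x + lambda(r), B) come close to both -P(x) and P(x), with |P(x)| = 1, and do
   not converge.  Off the exceptional sets prod b_k converges uniformly along the
   radius, which gives the radial limits. *)

(** * Reflections and periodic integrals *)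

(** Divergence is wanted at every x, whereas the infinite product is controlled only off null sets;
    hence the behaviour at x is read from nearby averages, never from the value at x. The delicate
    point is the order of the choices. The order n_k has to be large in terms of other data, yet the
    kernel must be concentrated at a scale at which b_k is almost constant, and that scale is
    proportional to 1/n_k. The two demands agree because lambda(r) is itself comparable to 1/n_k:
    the ratio of the scale to lambda(r) depends only on rho_k and on the tolerance. So the width of
    the exceptional arcs is taken from the budget left by the previous stage, rho_k from the width,
    the concentration ratio from rho_k, the range of r from that ratio, and only then n_k from the
    range. The measure of the arcs is bounded by their width uniformly in n_k, which leaves n_k
    free. Finally the lower bound 2 pi / n_k on lambda(r) keeps r away from 1, and equicontinuity
    yields the budget for the later stages. *)

Section lebesgue_reflection.
Context {R : realType}.
Local Notation L := (lebType R).
Local Open Scope ereal_scope.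

Lemma leb_borel_measurable (A : set R) : measurable A -> measurable (A : set L).
Proof. exact: sub_caratheodory. Qed.

Lemma leb_borelE (A : set R) : leb R A = lebesgue_measure A.
Proof. by []. Qed.

Lemma leb_itv_reflect (a b c : R) : (b <= c)%R ->
  leb R ((fun x : R => a - x)%R @^-1` `]b, c]) = (c - b)%:E.
Proof.
move=> bc.
have -> : (fun x : R => a - x)%R @^-1` `]b, c] = `[(a - c)%R, (a - b)%R[%classic.
  by apply/seteqP; split => x /=; rewrite !in_itv/= => /andP[]; lra.
rewrite leb_borelE lebesgue_measure_itv/= lte_fin -EFinB.
by case: ifPn => h; congr EFin; lra.
Qed.

(** Reflection maps a cover by half-open intervals to a cover by intervals of the same lengths.
    Arbitrary sets are treated because Caratheodory's criterion, on which [measurable_reflect]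
    rests, tests every set. *)
Lemma leb_reflect_le (a : R) (A : set R) :
  leb R ((fun x : R => a - x)%R @^-1` A) <= leb R A.
Proof.
apply: le_ereal_inf_tmp => _ [F [mF AF] <-].
apply: (@le_trans _ _ (leb R (\bigcup_k ((fun x : R => a - x)%R @^-1` (F k))))).
  apply: le_outer_measure => x /= /AF [k _ Fk].
  by exists k.
apply: (le_trans (outer_measure_sigma_subadditive _ _)).
apply: lee_nneseries => // k _.
have [[b c] _ <-] := mF k.
case: (leP b c) => bc.
  rewrite le_eqVlt; apply/orP; left; apply/eqP.
  exact: etrans (leb_itv_reflect a bc) (esym (wlength_itv_bnd idfun false false bc)).
rewrite set_itv_ge ?bnd_simp -?leNgt ?(ltW bc)//.
by rewrite preimage_set0 outer_measure0 measure0.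
Qed.

Lemma leb_reflect (a : R) (A : set R) :
  leb R ((fun x : R => a - x)%R @^-1` A) = leb R A.
Proof.
apply/eqP; rewrite eq_le leb_reflect_le/=.
have {1}-> : A = (fun x : R => a - x)%R @^-1` ((fun x : R => a - x)%R @^-1` A).
  by apply/seteqP; split => x /=; rewrite subKr.
exact: leb_reflect_le.
Qed.

(** Testing the preimage of A on X amounts to testing A on the reflection of X, and reflection
    preserves the outer measure. *)
Lemma measurable_reflect (a : R) : measurable_fun setT ((fun x : R => a - x)%R : L -> L).
Proof.
move=> _ A mA; rewrite setTI.
have {}mA (X : set R) : leb R X = leb R (X `&` A) + leb R (X `&` ~` A) := mA X.
suff H (X : set R) : leb R X = leb R (X `&` ((fun x : R => a - x)%R @^-1` A)) +
    leb R (X `&` ~` ((fun x : R => a - x)%R @^-1` A)) by exact: H.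
rewrite -(leb_reflect a X) (mA ((fun x : R => a - x)%R @^-1` X)).
rewrite -[X in X + _](leb_reflect a) -[X in _ + X](leb_reflect a).
by congr (leb R _ + leb R _); apply/seteqP; split => x /=; rewrite subKr.
Qed.

Lemma integral_reflect (a : R) (D : set L) (f : L -> \bar R) : measurable D ->
  measurable_fun D f -> (forall x, 0 <= f x) ->
  \int[leb R]_(x in (fun x : R => a - x)%R @^-1` D) f (a - x)%R = \int[leb R]_(x in D) f x.
Proof.
move=> mD mf f0.
rewrite -(@ge0_integral_pushforward _ _ _ _ _ _ (measurable_reflect a) (leb R) D f)//.
apply: eq_measure_integral; first exact: measurable_reflect.
by move=> mr A mA AD; exact: leb_reflect.
Qed.

End lebesgue_reflection.

Section periodic_integral.
Context {R : realType}.
Local Notation L := (lebType R).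
Local Open Scope ereal_scope.
Variables (T : R) (G : L -> \bar R).
Hypotheses (mG : measurable_fun setT G) (G0 : forall t, 0 <= G t)
  (perG : forall t : R, G (t + T)%R = G t).

Lemma leb_measurable_itv (i : interval R) : measurable ([set` i] : set L).
Proof. by apply: leb_borel_measurable; exact: measurable_itv. Qed.

Lemma periodic_int (z : int) (t : R) : G (t + T *~ z)%R = G t.
Proof.
have H n u : G (u + T *+ n)%R = G u.
  by elim: n u => [|n IH] u; rewrite ?mulr0n ?addr0// mulrS addrA IH perG.
case: z => n; first exact: H.
by rewrite NegzE mulrNz -(H n.+1 (t - _)%R) -pmulrn subrK.
Qed.

Lemma integral_itv_oc_co (a b : R) :
  \int[leb R]_(t in [set` `]a, b]]) G t = \int[leb R]_(t in [set` `[a, b[]) G t.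
Proof.
have [ab|ba] := ltP a b; last first.
  by rewrite !set_itv_ge ?bnd_simp -?leNgt.
have m1 (x : R) : measurable ([set x] : set L).
  by apply: leb_borel_measurable; exact: measurable_set1.
have n1 (x : R) : leb R [set x] = 0 by rewrite leb_borelE lebesgue_measure_set1.
have mG' D : measurable_fun D G by exact: measurable_funTS.
have mI := leb_measurable_itv.
rewrite (ge0_negligible_integral (m1 b) (mI _) (mG' _) _ (n1 b))//.
rewrite [RHS](ge0_negligible_integral (m1 a) (mI _) (mG' _) _ (n1 a))//.
by congr (integral _ _ _); apply/seteqP; split => x /=; rewrite !in_itv/= => -[/andP[h1 h2]] h3;
   (split; [|move=> E; subst x; lra]);
   apply/andP; split; try lra; rewrite lt_neqAle; apply/andP; split => //; apply/eqP => E;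
       apply: h3.
Qed.

Lemma integral_reflect_co (c a b : R) :
  \int[leb R]_(t in [set` `[a, b[]) G (c - t)%R =
  \int[leb R]_(t in [set` `[(c - b)%R, (c - a)%R[]) G t.
Proof.
rewrite -[RHS]integral_itv_oc_co -[RHS](integral_reflect c)//; last 2 first.
- exact: leb_measurable_itv.
- exact: measurable_funTS.
by congr (integral _ _ _); apply/seteqP; split => x /=; rewrite !in_itv/= => /andP[]; lra.
Qed.

End periodic_integral.

Section periodic_integral_shift.
Context {R : realType}.
Local Notation L := (lebType R).
Local Open Scope ereal_scope.
Variables (T : R) (G : L -> \bar R).
Hypotheses (T0 : (0 < T)%R) (mG : measurable_fun setT G) (G0 : forall t, 0 <= G t)
  (perG : forall t : R, G (t + T)%R = G t).

(** A translation is the composition of the reflections [t -> 0 - t] and [t -> c - t]. *)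
Lemma integral_shift_co (c a b : R) :
  \int[leb R]_(t in [set` `[a, b[]) G (t + c)%R =
  \int[leb R]_(t in [set` `[(a + c)%R, (b + c)%R[]) G t.
Proof.
have /= := @integral_reflect_co _ (fun t : R => G (c - t)%R) _ _ 0 a b.
rewrite /= !sub0r => E.
transitivity (\int[leb R]_(t in [set` `[(- b)%R, (- a)%R[]) G (c - t)%R).
  rewrite -E//; last by move: (measurableT_comp mG (measurable_reflect c)).
  by apply: eq_integral => x _; rewrite sub0r opprK addrC.
by rewrite integral_reflect_co// !opprK ![(c + _)%R]addrC.
Qed.

(** For 0 <= d < T the piece over [T, d + T[ is shifted back to [0, d[; a general c is reduced
    modulo T. *)
Lemma integral_periodic (c : R) :
  \int[leb R]_(t in [set` `[c, (c + T)%R[]) G t = \int[leb R]_(t in [set` `[0%R, T[]) G t.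
Proof.
have key d : (0 <= d < T)%R ->
    \int[leb R]_(t in [set` `[d, (d + T)%R[]) G t = \int[leb R]_(t in [set` `[0%R, T[]) G t.
  move=> /andP[d0 dT].
  have mI := @leb_measurable_itv R.
  have split3 (x y z : R) : (x <= y)%R -> (y <= z)%R ->
      \int[leb R]_(t in [set` `[x, z[]) G t =
      \int[leb R]_(t in [set` `[x, y[]) G t + \int[leb R]_(t in [set` `[y, z[]) G t.
    move=> xy yz; rewrite -ge0_integral_setU//.
    - congr (integral _ _ _); apply/seteqP; split => t /=; rewrite !in_itv/=.
        by move=> /andP[h1 h2]; case: (ltP t y) => h; [left|right]; apply/andP.
      by case=> /andP[h1 h2]; apply/andP; split; lra.
    - exact: measurable_funTS.
    - by apply/disj_setPS => t [] /=; rewrite !in_itv/= => /andP[_ h1] /andP[h2 _]; lra.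
  rewrite (split3 d T (d + T)%R)//; [|lra|lra].
  rewrite [RHS](split3 0%R d T)//; [|lra].
  rewrite addeC; congr (_ + _).
  have := integral_shift_co T 0 d; rewrite add0r => <-.
  by apply: eq_integral => x _; exact: perG.
set z := Num.floor (c / T)%R.
have [z1 z2] : (z%:~R * T <= c)%R /\ (c < z%:~R * T + T)%R.
  have /andP[] := floor_itv (c / T)%R; rewrite -/z.
  rewrite ler_pdivlMr// ltr_pdivrMr// => h1; rewrite intrD mulrDl mulr1z mul1r.
  by move=> h2; split.
have := @key (c - z%:~R * T)%R ltac:(lra) => <-.
have := integral_shift_co (z%:~R * T)%R (c - z%:~R * T)%R (c - z%:~R * T + T)%R.
have -> : (c - z%:~R * T + z%:~R * T = c)%R by ring.
have -> : (c - z%:~R * T + T + z%:~R * T = c + T)%R by ring.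
move=> <-; apply: eq_integral => x _.
by rewrite mulrC mulrzr (periodic_int perG).
Qed.

Lemma integral_periodic_reflect (c : R) :
  \int[leb R]_(t in [set` `[0%R, T[]) G (c - t)%R = \int[leb R]_(t in [set` `[0%R, T[]) G t.
Proof.
by rewrite integral_reflect_co// -(integral_periodic (c - T)) subr0 subrK.
Qed.

End periodic_integral_shift.

(** * Moebius factors *)

Section disc.
Context {R : realType}.
Local Open Scope complex_scope.
Local Notation C := R[i].
Local Notation nc := (@ComplexField.Normc.normc R).

Lemma normc_normC (z : C) : `|z| = (nc z)%:C.
Proof. by []. Qed.

Lemma normc_ge0 (z : C) : 0 <= nc z.
Proof. by rewrite -ler0c -normc_normC normr_ge0. Qed.

Lemma normcD (z w : C) : nc (z + w) <= nc z + nc w.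
Proof. exact: le_normcD. Qed.

Lemma normcNE (z : C) : nc (- z) = nc z.
Proof. exact: normcN. Qed.

Lemma normcB (z w : C) : nc (z - w) = nc (w - z).
Proof. by rewrite -normcNE opprB. Qed.

Lemma normcME (z w : C) : nc (z * w) = nc z * nc w.
Proof. exact: ComplexField.Normc.normcM. Qed.

Lemma normc0E : nc 0 = 0. Proof. exact: ComplexField.Normc.normc0. Qed.
Lemma normc1E : nc 1 = 1. Proof. exact: ComplexField.Normc.normc1. Qed.

Lemma normc_real (x : R) : nc x%:C = `|x|.
Proof. by rewrite /= expr0n/= addr0 sqrtr_sqr. Qed.

Lemma normcXE (z : C) n : nc (z ^+ n) = nc z ^+ n.
Proof. by elim: n => [|n IH]; rewrite ?expr0 ?normc1E// !exprS normcME IH. Qed.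

Lemma normc_eq0 (z : C) : (nc z == 0) = (z == 0).
Proof.
apply/eqP/eqP => [/ComplexField.Normc.eq0_normc//|->]; exact: normc0E.
Qed.

Lemma normc_gt0 (z : C) : (0 < nc z) = (z != 0).
Proof. by rewrite lt0r normc_ge0 andbT normc_eq0. Qed.

Lemma normc_divE (z w : C) : nc (z / w) = nc z / nc w.
Proof. by rewrite normcME ComplexField.Normc.normcV. Qed.

Lemma sqr_normcE (z : C) : nc z ^+ 2 = complex.Re z ^+ 2 + complex.Im z ^+ 2.
Proof. by case: z => a b /=; rewrite sqr_sqrtr// addr_ge0// sqr_ge0. Qed.

Lemma normc_sub_ge (z w : C) : nc z - nc w <= nc (z - w).
Proof. by rewrite lerBlDr -{1}[z](subrK w); exact: normcD. Qed.

Lemma ReB (z w : C) : complex.Re (z - w) = complex.Re z - complex.Re w.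
Proof. by case: z w => [? ?] []. Qed.

Lemma ImB (z w : C) : complex.Im (z - w) = complex.Im z - complex.Im w.
Proof. by case: z w => [? ?] []. Qed.

Lemma normc_ReIm (z : C) : nc z <= `|complex.Re z| + `|complex.Im z|.
Proof.
rewrite -(@ler_pXn2r _ 2) ?nnegrE ?normc_ge0 ?addr_ge0// sqr_normcE.
rewrite sqrrD !real_normK ?num_real//.
by rewrite addrAC lerDl mulrn_wge0// mulr_ge0.
Qed.

Lemma normc_geRe (z : C) : `|complex.Re z| <= nc z.
Proof.
rewrite -(@ler_pXn2r _ 2) ?nnegrE ?normc_ge0// sqr_normcE.
by rewrite real_normK ?num_real// lerDl sqr_ge0.
Qed.

Lemma normc_geIm (z : C) : `|complex.Im z| <= nc z.
Proof.
rewrite -(@ler_pXn2r _ 2) ?nnegrE ?normc_ge0// sqr_normcE.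
by rewrite real_normK ?num_real// lerDr sqr_ge0.
Qed.

Lemma normcB_mul (a b c d : C) : nc a <= 1 -> nc d <= 1 ->
  nc (a * b - c * d) <= nc (a - c) + nc (b - d).
Proof.
move=> a1 d1.
have -> : a * b - c * d = a * (b - d) + (a - c) * d by ring.
rewrite (le_trans (normcD _ _))// !normcME addrC lerD//.
  by rewrite ler_piMr// normc_ge0.
by rewrite ler_piMl// normc_ge0.
Qed.

Lemma blaschke_factorE (a z : C) : blaschke_factor a z =
  if a == 0 then z else `|a| / a * ((a - z) / (1 - conjc a * z)).
Proof. by []. Qed.

Lemma conjcM (z w : C) : conjc (z * w) = conjc z * conjc w.
Proof. exact: rmorphM. Qed.

(** * The unit circle and the factors evaluated on it *)

Definition expi (t : R) : C := cos t +i* sin t.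

Lemma expiD (a b : R) : expi (a + b) = expi a * expi b.
Proof. by rewrite /expi cosD sinD; congr (_ +i* _); rewrite addrC mulrC. Qed.

Lemma expi0 : expi 0 = 1. Proof. by rewrite /expi cos0 sin0. Qed.

Lemma expiX (a : R) n : expi a ^+ n = expi (n%:R * a).
Proof.
elim: n => [|n IH]; first by rewrite mul0r expi0.
by rewrite exprS IH -expiD -natr1 mulrDl mul1r addrC.
Qed.

Lemma normc_expi (t : R) : nc (expi t) = 1.
Proof. by rewrite /= cos2Dsin2 sqrtr1. Qed.

Lemma expi2pi : expi (2 * pi) = 1.
Proof. by rewrite /expi mulr_natl cos2pi sin2pi. Qed.

Lemma expi_periodic_nat (t : R) k : expi (t + k%:R * (2 * pi)) = expi t.
Proof. by rewrite expiD -expiX expi2pi expr1n mulr1. Qed.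

Lemma expi_periodic (t : R) (k : int) : expi (t + k%:~R * (2 * pi)) = expi t.
Proof.
case: k => n; first by rewrite expi_periodic_nat.
by rewrite NegzE -(expi_periodic_nat _ n.+1); congr expi; rewrite intrN mulNr subrK.
Qed.

Lemma sqr_normc_1Bexpi (t : R) : nc (1 - expi t) ^+ 2 = 2 - 2 * cos t.
Proof.
rewrite sqr_normcE /=.
have := cos2Dsin2 t; nra.
Qed.

Lemma normr_derive_le1_lip (f f' : R -> R) :
  (forall x : R, is_derive x (1 : R) f (f' x)) -> (forall x, `|f' x| <= 1) ->
  forall a b : R, `|f a - f b| <= `|a - b|.
Proof.
move=> df bf a b; wlog ab : a b / a <= b.
  by move=> H; case/orP: (le_total a b) => h; [|rewrite distrC [leRHS]distrC]; exact: H.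
rewrite distrC [leRHS]distrC.
have cf : {within `[a, b], continuous f}.
  by apply: derivable_within_continuous => x _; exact: ex_derive.
have [c _ ->] := @MVT_segment R f f' a b ab (fun x _ => df x) cf.
by rewrite normrM ler_piMl.
Qed.

Lemma expi_lip (a b : R) : nc (expi a - expi b) <= 2 * `|a - b|.
Proof.
apply: (le_trans (normc_ReIm _)); rewrite mulr_natl mulr2n lerD//=.
  apply: (@normr_derive_le1_lip cos (fun x => - sin x)) => // x; rewrite normrN.
  by rewrite ler_norml sin_geN1 sin_le1.
apply: (@normr_derive_le1_lip sin cos) => // x.
by rewrite ler_norml cos_geN1 cos_le1.
Qed.

(* At [w = z ^+ n], the value at z of the Blaschke product whose zeros are the n-th
   roots of q. *)
Definition moebius (q : R) (w : C) : C := (q%:C - w) / (1 - q%:C * w).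

Lemma normc_moebius_den (q : R) (w : C) : 0 <= q -> q < 1 -> nc w <= 1 -> 1 - q <= nc (1 - q%:C
    * w).
Proof.
move=> q0 q1 w1; apply: le_trans (normc_sub_ge _ _).
by rewrite normc1E normcME normc_real ger0_norm// lerD2l lerN2 ler_piMr.
Qed.

Lemma moebius_den_neq0 (q : R) (w : C) : 0 <= q -> q < 1 -> nc w <= 1 -> 1 - q%:C * w != 0.
Proof.
by move=> q0 q1 w1; rewrite -normc_gt0 (lt_le_trans _ (normc_moebius_den q0 q1 w1))// subr_gt0.
Qed.

(** The right-hand side is nonnegative on the disc and vanishes on the circle; this is why
    [moebius q] maps the disc into itself and is unimodular on the circle. *)
Lemma normc_moebius_num (q : R) (w : C) :
  nc (1 - q%:C * w) ^+ 2 - nc (q%:C - w) ^+ 2 = (1 - q ^+ 2) * (1 - nc w ^+ 2).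
Proof. by rewrite !sqr_normcE; case: w => a b /=; ring. Qed.

Lemma normc_moebius_le1 (q : R) (w : C) : 0 <= q -> q < 1 -> nc w <= 1 -> nc (moebius q w) <= 1.
Proof.
move=> q0 q1 w1; have d0 := moebius_den_neq0 q0 q1 w1; rewrite -normc_gt0 in d0.
rewrite normc_divE ler_pdivrMr// mul1r.
rewrite -(@ler_pXn2r _ 2) ?nnegrE ?normc_ge0// -subr_ge0 normc_moebius_num.
by rewrite mulr_ge0// subr_ge0 expr_le1 ?normc_ge0// ltW.
Qed.

Lemma normc_moebius_eq1 (q : R) (w : C) : 0 <= q -> q < 1 -> nc w = 1 -> nc (moebius q w) = 1.
Proof.
move=> q0 q1 w1; have d0 : 1 - q%:C * w != 0 by apply: moebius_den_neq0 => //; rewrite w1.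
rewrite -normc_gt0 in d0; rewrite normc_divE.
suff -> : nc (q%:C - w) = nc (1 - q%:C * w) by rewrite divff// gt_eqF.
apply/eqP; rewrite -(@eqrXn2 _ 2) ?normc_ge0// eq_sym -subr_eq0 normc_moebius_num.
by rewrite w1 expr1n subrr mulr0.
Qed.

(** Here 1 - [moebius q (s w)] is (1 - q)(1 + s w) / (1 - q s w), where |1 + s w| <= 2, and |1 - w|
    <= 2 |1 - q s w| because |1 - q s w| >= 1 - q s. The bound is free of s, so a whole radius is
    covered at once. *)
Lemma moebius_far (q : R) (w : C) (s : R) : 0 <= q -> q < 1 -> nc w = 1 -> 0 <= s <= 1 ->
  nc (1 - moebius q (s%:C * w)) * nc (1 - w) <= 4 * (1 - q).
Proof.
move=> q0 q1 w1 /andP[s0 s1].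
have sw : nc (s%:C * w) <= 1 by rewrite normcME w1 mulr1 normc_real ger0_norm.
have d0 := moebius_den_neq0 q0 q1 sw.
have d1 : 0 < nc (1 - q%:C * (s%:C * w)) by rewrite normc_gt0.
have -> : 1 - moebius q (s%:C * w) =
    (1 - q%:C) * (1 + s%:C * w) / (1 - q%:C * (s%:C * w)).
  by rewrite /moebius; field.
have -> : 1 - q%:C = (1 - q)%:C by rewrite rmorphB rmorph1.
rewrite normc_divE normcME normc_real gtr0_norm ?subr_gt0// mulrAC ler_pdivrMr//.
have h1 : nc (1 + s%:C * w) <= 2.
  by rewrite (le_trans (normcD _ _))// normc1E; lra.
have h2 : nc (1 - w) <= 2 * nc (1 - q%:C * (s%:C * w)).
  have qs : 0 <= q * s <= 1 by apply/andP; split;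
      [exact: mulr_ge0|by rewrite mulr_ile1 ?(ltW q1)].
  have -> : 1 - w = (1 - q%:C * (s%:C * w)) + (q * s - 1)%:C * w.
    by rewrite rmorphB rmorph1 rmorphM/=; ring.
  rewrite (le_trans (normcD _ _))// [X in _ <= X]mulr_natl mulr2n lerD2l.
  rewrite normcME w1 mulr1 normc_real ler0_norm ?subr_le0; last by case/andP: qs.
  rewrite opprB; apply: le_trans (normc_sub_ge _ _).
  rewrite normc1E !normcME w1 mulr1 !normc_real !ger0_norm//.
have h3 := normc_ge0 (1 - w); have h4 := normc_ge0 (1 + s%:C * w).
have : nc (1 + s%:C * w) * nc (1 - w) <= 2 * (2 * nc (1 - q%:C * (s%:C * w))).
  exact: ler_pM.
have q1' : 0 <= 1 - q by rewrite subr_ge0 ltW.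
move=> /(ler_wpM2l q1'); lra.
Qed.

(** The value at w = 1 is -1. The factor 1 - q in the estimate is what makes the later kernel window
    proportional to [1 - radius]. *)
Lemma moebius_near (q : R) (w : C) : 0 <= q -> q < 1 -> nc w <= 1 ->
  nc (1 + moebius q w) * (1 - q) <= 2 * nc (1 - w).
Proof.
move=> q0 q1 w1; have d0 := moebius_den_neq0 q0 q1 w1.
have d1 := normc_moebius_den q0 q1 w1.
have d2 : 0 < nc (1 - q%:C * w) by rewrite normc_gt0.
have -> : 1 + moebius q w = (1 + q)%:C * (1 - w) / (1 - q%:C * w).
  by rewrite /moebius rmorphD rmorph1/=; field.
rewrite normc_divE normcME normc_real ger0_norm ?addr_ge0// mulrAC ler_pdivrMr//.
have h3 := normc_ge0 (1 - w).
have : (1 + q) * nc (1 - w) * (1 - q) <= 2 * nc (1 - w) * (1 - q) by have := mulr_ge0 h3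
    (sqr_ge0 (1 - q)); lra.
by move=> h; apply: (le_trans h); rewrite ler_wpM2l// mulr_ge0.
Qed.

Lemma moebius_lip (q : R) (w w' : C) : 0 <= q -> q < 1 -> nc w <= 1 -> nc w' <= 1 ->
  nc (moebius q w - moebius q w') * (1 - q) <= 2 * nc (w - w').
Proof.
move=> q0 q1 w1 w1'; have d0 := moebius_den_neq0 q0 q1 w1; have d0' := moebius_den_neq0 q0 q1 w1'.
have d1 := normc_moebius_den q0 q1 w1; have d1' := normc_moebius_den q0 q1 w1'.
have d2 : 0 < nc (1 - q%:C * w) by rewrite normc_gt0.
have d2' : 0 < nc (1 - q%:C * w') by rewrite normc_gt0.
have -> : moebius q w - moebius q w' =
    (q ^+ 2 - 1)%:C * (w - w') / ((1 - q%:C * w) * (1 - q%:C * w')).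
  by rewrite /moebius rmorphB rmorphXn rmorph1/=; field; rewrite d0 d0'.
rewrite normc_divE !normcME normc_real ler0_norm; last by rewrite subr_le0 expr_le1 // ltW.
rewrite mulrAC ler_pdivrMr ?mulr_gt0//.
have h3 := normc_ge0 (w - w').
have h : (1 - q) * (1 - q) <= nc (1 - q%:C * w) * nc (1 - q%:C * w').
  by apply: ler_pM => //; rewrite subr_ge0 ltW.
have : - (q ^+ 2 - 1) * nc (w - w') * (1 - q) <= 2 * nc (w - w') * ((1 - q) * (1 - q)).
  have -> : - (q ^+ 2 - 1) * nc (w - w') * (1 - q) =
    (1 + q) * (nc (w - w') * ((1 - q) * (1 - q))) by ring.
  by rewrite -mulrA; apply: ler_wpM2r; [rewrite !mulr_ge0 ?subr_ge0 ?(ltW q1)|lra].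
by move=> h'; apply: (le_trans h'); rewrite ler_wpM2l// mulr_ge0.
Qed.


Lemma expi_prim n : (0 < n)%N -> n.-primitive_root (expi (2 * pi / n%:R)).
Proof.
move=> n0; apply/andP; split => //; apply/forallP => -[i iN] /=.
have nR : 0 < n%:R :> R by rewrite ltr0n.
rewrite unity_rootE expiX; apply/eqP.
have [->|] := eqVneq i.+1 n.
  by rewrite mulrCA divff ?(gt_eqF nR)// mulr1 expi2pi !eqxx.
move=> ne; rewrite eq_complex/=; apply/negbTE/negP => /andP[/eqP c1 /eqP].
have iln : (i.+1 < n)%N by rewrite ltn_neqAle ne.
set t := (_ * _) in c1 *.
have t2 : 0 < t < 2 * pi.
  rewrite /t mulr_gt0 ?divr_gt0 ?mulr_gt0 ?pi_gt0//=.
  by rewrite mulrCA gtr_pMr ?mulr_gt0 ?pi_gt0// ltr_pdivrMr// mul1r ltr_nat.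
have [tp|tp] := leP t pi.
  suff : cos t < cos 0 by rewrite cos0 c1 ltxx.
  by rewrite ltr_cos ?in_itv//=; lra.
suff : cos (2 * pi - t) < cos 0.
  by rewrite cos0 mulr_natl cosB cos2pi sin2pi c1 !mul1r mul0r addr0 ltxx.
by rewrite ltr_cos ?in_itv//=; lra.
Qed.

(** Since the conjugate of q e^l is q / e^l, the normalized factor becomes (z - q e^l) / (q z -
    e^l). Numerators and denominators are then multiplied by means of X^n - 1 = prod (X - e^l); no
    unimodular constant is left over. *)
Lemma prod_blaschke_factor n (q : R) (z : C) : (0 < n)%N -> 0 < q < 1 -> nc z < 1 ->
  \prod_(0 <= l < n) blaschke_factor (q%:C * expi (2 * pi / n%:R) ^+ l) z
  = moebius (q ^+ n) (z ^+ n).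
Proof.
move=> n0 /andP[q0 q1] z1; set e := expi _.
have e1 : nc e = 1 by exact: normc_expi.
have qC : q%:C != 0 :> C by rewrite -normc_gt0 normc_real normr_gt0 gt_eqF.
have eX l : nc (e ^+ l) = 1 by rewrite normcXE e1 expr1n.
have eX0 l : e ^+ l != 0 by rewrite -normc_gt0 eX.
have den l : q%:C * z - e ^+ l != 0.
  rewrite -normc_gt0 normcB; apply: lt_le_trans (normc_sub_ge _ _).
  rewrite eX normcME normc_real gtr0_norm// subr_gt0.
  have := normc_ge0 z; nra.
have -> : \prod_(0 <= l < n) blaschke_factor (q%:C * e ^+ l) z =
    \prod_(0 <= l < n) ((z - q%:C * e ^+ l) / (q%:C * z - e ^+ l)).
  apply: eq_bigr => l _; rewrite blaschke_factorE ifF; last first.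
    by rewrite mulf_eq0 (negbTE qC) (negbTE (eX0 l)).
  have nE : `|q%:C * e ^+ l| = q%:C :> C.
    by rewrite normc_normC normcME eX mulr1 normc_real gtr0_norm.
  have cE : conjc (q%:C * e ^+ l) = q%:C / e ^+ l.
    transitivity (conjc q%:C * conjc (e ^+ l)); first exact: conjcM.
    congr (_ * _); first exact: conjc_real.
    by rewrite [in RHS]invc_norm normc_normC eX rmorph1 expr1n invr1 mul1r.
  rewrite nE cE.
  have d' : e ^+ l - q%:C * z != 0 by rewrite -opprB oppr_eq0.
  by field; apply/and4P; split; [exact: den|exact: eX0|exact: d'|exact: qC].
rewrite prodf_div.
have P (x : C) : \prod_(0 <= l < n) (x - e ^+ l) = x ^+ n - 1.
  have -> : x ^+ n - 1 = ('X^n - 1).[x] by rewrite !hornerE.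
  rewrite -(factor_Xn_sub_1 (expi_prim n0)) horner_prod.
  by apply: eq_bigr => i _; rewrite hornerXsubC.
rewrite P.
have -> : \prod_(0 <= l < n) (z - q%:C * e ^+ l) = q%:C ^+ n * ((z / q%:C) ^+ n - 1).
  rewrite -P -[in q%:C ^+ n](subn0 n) -prodr_const_nat -big_split/=.
  by apply: eq_bigr => l _; field.
have dd : (q%:C * z) ^+ n - 1 != 0.
  by rewrite -P prodf_seq_neq0; apply/allP => l _; exact: den.
rewrite /moebius rmorphXn/= expr_div_n exprMn mulrBr mulr1 mulrCA divff ?expf_neq0// mulr1.
rewrite exprMn in dd.
have dd' : 1 - q%:C ^+ n * z ^+ n != 0 by rewrite -opprB oppr_eq0.
by field; rewrite dd dd'.
Qed.

(** For a nonzero, 1 - b_a(z) equals (1 - |a|)(a + |a| z) / (a (1 - conj(a) z)). The estimate turns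
    the Blaschke condition into summable increments of the partial products at each fixed z. *)
Lemma normc_1Bblaschke (a z : C) : nc a < 1 -> nc z < 1 ->
  nc (1 - blaschke_factor a z) * (1 - nc z) <= 2 * (1 - nc a).
Proof.
move=> a1 z1; rewrite blaschke_factorE; case: ifPn => [/eqP->|a0].
  rewrite normc0E subr0 mulr1.
  have : nc (1 - z) <= 1 + nc z by rewrite (le_trans (normcD _ _))// normc1E normcNE.
  have := normc_ge0 z; have := normc_ge0 (1 - z); nra.
have aR : nc (conjc a) = nc a.
  by have := normcJ a; rewrite !normc_normC => /complexI.
have d1 : 1 - nc z <= nc (1 - conjc a * z).
  apply: le_trans (normc_sub_ge _ _); rewrite normc1E normcME aR lerD2l lerN2.
  by rewrite ler_piMl ?normc_ge0// ltW.
have d0 : 0 < nc (1 - conjc a * z) by apply: lt_le_trans d1; rewrite subr_gt0.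
have d0' : 1 - conjc a * z != 0 by rewrite -normc_gt0.
have aa : a * conjc a = `|a| ^+ 2 by rewrite sqr_normc.
have -> : 1 - `|a| / a * ((a - z) / (1 - conjc a * z)) =
    (1 - `|a|) * (a + `|a| * z) / (a * (1 - conjc a * z)).
  apply: (@mulIf _ (a * (1 - conjc a * z))); first by rewrite mulf_neq0.
  rewrite divfK ?mulf_neq0//.
  have -> : (1 - `|a| / a * ((a - z) / (1 - conjc a * z))) * (a * (1 - conjc a * z)) =
     a - (a * conjc a) * z - `|a| * (a - z).
    by field; apply/andP; split.
  by rewrite aa; ring.
have n1 : 0 < nc a by rewrite normc_gt0.
rewrite normc_normC; have -> : 1 - (nc a)%:C = (1 - nc a)%:C by rewrite rmorphB rmorph1.
rewrite normc_divE !normcME normc_real gtr0_norm ?subr_gt0//.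
have h1 : nc (a + (nc a)%:C * z) <= nc a * 2.
  rewrite (le_trans (normcD _ _))// normcME normc_real gtr0_norm//.
  have := normc_ge0 z; nra.
rewrite mulrAC ler_pdivrMr ?mulr_gt0//.
have : (1 - nc a) * nc (a + (nc a)%:C * z) <= (1 - nc a) * (nc a * 2).
  by rewrite ler_wpM2l// subr_ge0 ltW.
have : nc a * (1 - nc z) <= nc a * nc (1 - conjc a * z) by rewrite ler_pM2l.
have := normc_ge0 (a + (nc a)%:C * z).
set X := nc (a + _); set D := nc (1 - _); move=> X0 e1 e2.
apply: (@le_trans _ _ ((1 - nc a) * (nc a * 2) * (1 - nc z))).
  by rewrite ler_wpM2r// subr_ge0 ltW.
have -> : (1 - nc a) * (nc a * 2) * (1 - nc z) = 2 * (1 - nc a) * (nc a * (1 - nc z)) by ring.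
by rewrite ler_wpM2l// mulr_ge0// subr_ge0 ltW.
Qed.

Lemma normc_blaschke_le1 (a z : C) : nc a < 1 -> nc z < 1 ->
  nc (blaschke_factor a z) <= 1.
Proof.
move=> a1 z1; rewrite blaschke_factorE; case: ifPn => [_|a0]; first exact: ltW.
have aR : nc (conjc a) = nc a.
  by have := normcJ a; rewrite !normc_normC => /complexI.
have d0 : 0 < nc (1 - conjc a * z).
  apply: lt_le_trans (normc_sub_ge _ _); rewrite normc1E normcME aR subr_gt0.
  have := normc_ge0 a; have := normc_ge0 z; nra.
have n1 : 0 < nc a by rewrite normc_gt0.
rewrite normcME !normc_divE normc_normC normc_real gtr0_norm// divff ?gt_eqF// mul1r.
rewrite ler_pdivrMr// mul1r -(@ler_pXn2r _ 2) ?nnegrE ?normc_ge0// -subr_ge0.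
have -> : nc (1 - conjc a * z) ^+ 2 - nc (a - z) ^+ 2 = (1 - nc a ^+ 2) * (1 - nc z ^+ 2).
  by rewrite !sqr_normcE; case: (a) => a' b'; case: (z) => c d /=; ring.
by rewrite mulr_ge0// subr_ge0 expr_le1 ?normc_ge0// ltW.
Qed.

End disc.

(** * Blaschke products from blocks of roots *)

Section convergence.
Context {R : realType}.
Local Open Scope complex_scope.
Local Notation C := R[i].
Local Notation nc := (@ComplexField.Normc.normc R).

Lemma cvg_normcP (T : Type) (F : set_system T) (FF : Filter F) (f : T -> C) (l : C) :
  ((f : T -> R[i]^o) @ F --> (l : R[i]^o)) <->
  (forall e : R, 0 < e -> \forall x \near F, nc (f x - l) < e).
Proof.
split => [/cvgrPdist_lt H e e0|H].
  have /H : 0 < e%:C :> C by rewrite ltcR.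
  apply: filterS => x; rewrite distrC normc_normC ltcR; exact.
apply/cvgrPdist_lt => e; rewrite ltcE/= => /andP[/eqP ei er].
have := H _ er; apply: filterS => x h.
by rewrite distrC normc_normC ltcE/= ei eqxx.
Qed.

Lemma cvg_normc_le (T : Type) (F : set_system T) (FF : ProperFilter F) (f : T -> C) (l v : C)
    (d : R) :
  ((f : T -> R[i]^o) @ F --> (l : R[i]^o)) ->
  (\forall x \near F, nc (f x - v) <= d) -> nc (l - v) <= d.
Proof.
move=> /cvg_normcP H Hd; apply/ler_addgt0Pr => e e0.
have [x [h1 h2]] := filter_ex (filterI (H _ e0) Hd).
have -> : l - v = (l - f x) + (f x - v) by ring.
rewrite (le_trans (normcD _ _))// addrC lerD// normcB; exact: ltW.
Qed.

Lemma cvg_ReIm (u : nat -> C) (l : C) :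
  (u : nat -> R[i]^o) @ \oo --> (l : R[i]^o) <->
  (complex.Re (u n) @[n --> \oo] --> complex.Re l) /\
  (complex.Im (u n) @[n --> \oo] --> complex.Im l).
Proof.
split => [/cvg_normcP H|[/cvgrPdist_lt H1 /cvgrPdist_lt H2]].
  by split; apply/cvgrPdist_lt => e e0; have := H _ e0; apply: filterS => n; apply: le_lt_trans;
     rewrite distrC -?ReB -?ImB ?normc_geRe ?normc_geIm.
apply/cvg_normcP => e e0.
have e2 : 0 < e / 2 by rewrite divr_gt0.
near=> n; apply: (le_lt_trans (normc_ReIm _)); rewrite ReB ImB [e]splitr ltrD//.
  by rewrite distrC; near: n; exact: H1.
by rewrite distrC; near: n; exact: H2.
Unshelve. all: by end_near. Qed.

(** Each coordinate is its initial value plus an absolutely convergent telescoping series. *)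
Lemma cvg_summable_variation (u : nat -> C) (c : nat -> R) :
  (forall n, nc (u n.+1 - u n) <= c n) -> cvgn (series c) ->
  exists l : C, (u : nat -> R[i]^o) @ \oo --> (l : R[i]^o).
Proof.
move=> uc cc.
have K (v : nat -> R) : (forall n, `|v n.+1 - v n| <= c n) -> cvgn v.
  move=> vc.
  have H : cvgn (series (telescope v)).
    apply: normed_cvg; apply: (@series_le_cvg _ _ c _ _ _ cc) => n /=.
    - exact: normr_ge0.
    - exact: le_trans (vc n).
    - exact: vc.
  have E : v = (fun n => v 0%N + series (telescope v) n).
    by apply/funext => n; exact: eq_sum_telescope.
  rewrite E; apply: is_cvgD => //; exact: is_cvg_cst.
have cR : cvgn (fun n => complex.Re (u n)).
  by apply: K => n; rewrite -ReB (le_trans (normc_geRe _)).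
have cI : cvgn (fun n => complex.Im (u n)).
  by apply: K => n; rewrite -ImB (le_trans (normc_geIm _)).
exists (limn (fun n => complex.Re (u n)) +i* limn (fun n => complex.Im (u n))).
by apply/cvg_ReIm; split.
Qed.

Lemma normc_prod_le1 (f : nat -> C) K : (forall j, (j < K)%N -> nc (f j) <= 1) ->
  nc (\prod_(0 <= j < K) f j) <= 1.
Proof.
elim: K => [|K IH] H; first by rewrite big_geq// normc1E.
rewrite big_nat_recr//= normcME mulr_ile1 ?normc_ge0 ?H//.
by apply: IH => j jK; apply: H; rewrite ltnW.
Qed.

Lemma prod_step_le (f : nat -> C) K : (forall j, nc (f j) <= 1) ->
  nc (\prod_(0 <= j < K.+1) f j - \prod_(0 <= j < K) f j) <= nc (1 - f K).
Proof.
move=> H; rewrite big_nat_recr//= -{2}[\prod_(0 <= j < K) f j]mulr1 -mulrBr normcME normcB.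
by rewrite ler_piMl ?normc_ge0// normc_prod_le1.
Qed.

Lemma prod_tail_le (f : nat -> C) (c : nat -> R) K M : (forall j, nc (f j) <= 1) ->
  (K <= M)%N -> (forall j, (K <= j < M)%N -> nc (1 - f j) <= c j) ->
  nc (\prod_(0 <= j < M) f j - \prod_(0 <= j < K) f j) <= \sum_(K <= j < M) c j.
Proof.
move=> f1 KM; elim: M KM => [|M IH].
  by rewrite leqn0 => /eqP-> _; rewrite subrr normc0E big_geq.
rewrite leq_eqVlt => /orP[/eqP<- _|]; first by rewrite subrr normc0E big_geq.
rewrite ltnS => KM H; rewrite [leRHS]big_nat_recr//=.
have -> : \prod_(0 <= j < M.+1) f j - \prod_(0 <= j < K) f j =
  (\prod_(0 <= j < M) f j - \prod_(0 <= j < K) f j) +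
  (\prod_(0 <= j < M.+1) f j - \prod_(0 <= j < M) f j) by ring.
rewrite (le_trans (normcD _ _))// lerD//.
  by apply: IH => // j /andP[h1 h2]; apply: H; rewrite h1 ltnW.
by rewrite (le_trans (prod_step_le _ f1))// H// KM ltnSn.
Qed.

(** The entry of index i is read in the concatenation of the first i + 1 blocks, which has more than
    i entries as no block is empty. The bound K <= n makes the block ends cofinal among the
    indices. *)
Lemma enumerate_blocks (T : Type) (x0 : T) (blk : nat -> seq T) :
  (forall j, 0 < size (blk j))%N ->
  exists a : nat -> T, forall K, exists2 n, (K <= n)%N &
    flatten [seq blk j | j <- iota 0 K] = [seq a i | i <- iota 0 n].
Proof.
move=> blk0; pose S K := flatten [seq blk j | j <- iota 0 K].
have SD K d : S (K + d)%N = S K ++ flatten [seq blk j | j <- iota K d].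
  by rewrite /S iotaD map_cat flatten_cat.
have sS K : (K <= size (S K))%N.
  elim: K => // K IH; rewrite -addn1 SD size_cat/= cats0.
  by rewrite leq_add.
exists (fun i => nth x0 (S i.+1) i) => K; exists (size (S K)); first exact: sS.
apply: (@eq_from_nth _ x0); first by rewrite size_map size_iota.
move=> i iK; rewrite (nth_map 0%N) ?size_iota// nth_iota// add0n.
have [h|h] := leqP i.+1 K.
  by rewrite -/(S K) -[in LHS](subnKC h) SD nth_cat sS.
by rewrite -/(S K) -[in RHS](subnKC (ltnW h)) SD nth_cat iK.
Qed.

Lemma root_exists (rho : R) n : (0 < n)%N -> 0 < rho < 1 ->
  exists2 q : R, 0 < q < 1 & q ^+ n = rho.
Proof.
move=> n0 /andP[r0 r1]; exists (powR rho n%:R^-1).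
  rewrite powR_gt0//= /powR gt_eqF// -[ltRHS](@expR0 R) ltr_expR.
  by rewrite pmulr_rlt0 ?invr_gt0 ?ltr0n// ln_lt0// r0.
rewrite -powR_mulrn ?powR_ge0// -powRrM mulVf ?powRr1 ?ltW//.
by rewrite pnatr_eq0 -lt0n.
Qed.

(** For q < 1 the quotient (1 - q^n) / (1 - q) is a sum of n powers of q, each at least q^n. With
    q^n = rho this bounds the Blaschke sum n (1 - q) of a block of roots by (1 - rho) / rho. *)
Lemma bernoulli_root (q : R) n : 0 <= q <= 1 -> n%:R * (1 - q) * q ^+ n <= 1 - q ^+ n.
Proof.
move=> /andP[q0 q1]; elim: n => [|n IH]; first by rewrite !mul0r expr0 subrr.
have qn : 0 <= q ^+ n by exact: exprn_ge0.
have h : 0 <= n.+1%:R * (1 - q) * q ^+ n * (1 - q) by rewrite !mulr_ge0// subr_ge0.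
move: IH h; rewrite exprS -natr1; set X := q ^+ n; set N := n%:R; nra.
Qed.

(** The block of index j has Blaschke sum at most 2^-j, so the enumerated zeros satisfy the Blaschke
    condition; the products over whole blocks are a subsequence of the products over single
    zeros. *)
Lemma blaschke_product_exists (n : nat -> nat) (rho : nat -> R) :
  (forall j, 0 < n j)%N -> (forall j, 0 < rho j < 1) ->
  (forall j, 1 - rho j <= 2^-1 ^+ j.+1) ->
  exists2 b : C -> C, blaschke_product b &
    forall z, nc z < 1 ->
      ((fun K => \prod_(0 <= j < K) moebius (rho j) (z ^+ n j)) : nat -> R[i]^o)
        @ \oo --> (b z : R[i]^o).
Proof.
move=> n0 rho01 rhoB.
have /choice [q qP] : forall j, exists q : R, 0 < q < 1 /\ q ^+ n j = rho j.
  by move=> j; have [q h1 h2] := root_exists (n0 j) (rho01 j); exists q.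
pose blk j := [seq ((q j)%:C * expi (2 * pi / (n j)%:R) ^+ l : C) | l <- iota 0 (n j)].
have [|a aP] := @enumerate_blocks _ (0 : C) blk.
  by move=> j; rewrite size_map size_iota.
have blkP (f : C -> C) K N : flatten [seq blk j | j <- iota 0 K] = [seq a i | i <- iota 0 N] ->
    \prod_(0 <= i < N) f (a i) = \prod_(0 <= j < K) \prod_(0 <= l < n j)
      f ((q j)%:C * expi (2 * pi / (n j)%:R) ^+ l).
  move=> E; rewrite /index_iota !subn0 -(big_map a xpredT f) -E big_flatten big_map.
  by apply: eq_bigr => j _; rewrite big_map subn0.
have blkS (f : C -> R) K N : flatten [seq blk j | j <- iota 0 K] = [seq a i | i <- iota 0 N] ->
    \sum_(0 <= i < N) f (a i) = \sum_(0 <= j < K) \sum_(0 <= l < n j)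
      f ((q j)%:C * expi (2 * pi / (n j)%:R) ^+ l).
  move=> E; rewrite /index_iota !subn0 -(big_map a xpredT f) -E big_flatten big_map.
  by apply: eq_bigr => j _; rewrite big_map subn0.
have nq j l : nc ((q j)%:C * expi (2 * pi / (n j)%:R) ^+ l) = q j.
  rewrite normcME normcXE normc_expi expr1n mulr1 normc_real gtr0_norm//.
  by have [/andP[]] := qP j.
have a1 i : nc (a i) < 1.
  have [N iN E] := aP i.+1.
  have : a i \in flatten [seq blk j | j <- iota 0 i.+1].
    by rewrite E; apply: map_f; rewrite mem_iota.
  move=> /flattenP[s /mapP[j _ ->] /mapP[l _ ->]]; rewrite nq.
  by have [/andP[]] := qP j.
have cs : cvgn (series (fun i => 1 - nc (a i))).
  apply: nondecreasing_is_cvgn.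
    apply/nondecreasing_seqP => i; rewrite seriesSr lerDl subr_ge0 ltW//.
  (* The bound 2 is the sum of all 2^-j; a partial sum is first extended to the end of a block. *)
  exists 2 => _ [N _ <-]; have [M NM E] := aP N.
  apply: (@le_trans _ _ (series (fun i => 1 - nc (a i)) M)).
    rewrite /series/= (big_cat_nat (leq0n N) NM)//= lerDl sumr_ge0// => i _.
    by rewrite subr_ge0 ltW.
  rewrite /series/= (blkS (fun w => 1 - nc w) _ _ E).
  apply: (@le_trans _ _ (\sum_(0 <= j < N) 2^-1 ^+ j)).
    apply: ler_sum => j _; under eq_bigr do rewrite nq.
    rewrite sumr_const_nat subn0 -[leLHS]mulr_natl.
    have [/andP[q0 q1] qr] := qP j.
    have q01 : 0 <= q j <= 1 by rewrite !ltW.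
    have h := bernoulli_root (n j) q01; rewrite qr in h; have := rhoB j;
        have /andP[r0 r1] := rho01 j.
    have hj : 2^-1 ^+ j <= (1 : R) by rewrite exprn_ile1// ?invr_ge0// invf_le1// ler1n.
    rewrite exprS; set X := 2^-1 ^+ j in hj *; move=> h'.
    (* As rho is at least 1/2, dividing by it at most doubles 1 - rho. *)
    have r2 : 2^-1 <= rho j by lra.
    have : (n j)%:R * (1 - q j) * 2^-1 <= (n j)%:R * (1 - q j) * rho j.
      by rewrite ler_wpM2l// mulr_ge0// subr_ge0 ltW.
    move: h; set Y := (n j)%:R * (1 - q j). lra.
  rewrite (_ : \sum_(0 <= j < N) _ = (1 - 2^-1 ^+ N) * 2).
    have : 0 <= 2^-1 ^+ N :> R by rewrite exprn_ge0.
    lra.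
  elim: (N) => [|N' IH]; first by rewrite big_geq// expr0 subrr mul0r.
  by rewrite big_nat_recr//= IH exprS; field.
have lP z : exists l : C, nc z < 1 ->
    ((fun N => \prod_(0 <= i < N) blaschke_factor (a i) z) : nat -> R[i]^o) @ \oo --> (l :
        R[i]^o).
  have [z1|z1] := ltP (nc z) 1; last by exists 0.
  have [|l lP] := @cvg_summable_variation (fun N => \prod_(0 <= i < N) blaschke_factor (a i) z)
    (fun i => (2 / (1 - nc z)) * (1 - nc (a i))) _ ((@is_cvg_seriesZ _ _ _ cs)).
    move=> i; rewrite (le_trans (prod_step_le _ _))// => [j|].
      exact: normc_blaschke_le1.
    rewrite mulrAC ler_pdivlMr ?subr_gt0//; exact: normc_1Bblaschke.
  by exists l.
have [b bP] := choice lP.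
exists b.
  exists predT, a; split => //.
    by move=> k _; rewrite normc_normC -[1]/(1%:C) ltcR.
  move=> z; rewrite normc_normC -[1]/(1%:C) ltcR; exact: bP.
move=> z z1; apply/cvg_normcP => e e0.
have /cvg_normcP/(_ _ e0) [N _ HN] := bP z z1.
exists N => // K NK; have [M KM E] := aP K.
have := HN M (leq_trans NK KM); rewrite (blkP (fun w => blaschke_factor w z) _ _ E).
congr (nc (_ - _) < _); apply: eq_bigr => j _.
have [h1 h2] := qP j; by rewrite prod_blaschke_factor// h2.
Qed.

End convergence.

(** * Exceptional sets and concentration of the kernels *)

Section exceptional_set.
Context {R : realType}.
Local Notation L := (lebType R).
Local Open Scope ereal_scope.

Lemma continuous_leb_measurable (f : R -> R) : continuous f ->
  measurable_fun [set: L] (f : L -> R).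
Proof.
move=> cf _ A mA; rewrite setTI.
have := continuous_measurable_fun cf measurableT mA; rewrite setTI.
exact: leb_borel_measurable.
Qed.

Lemma continuous_cosM (c : R) : continuous (fun t : R => cos (c * t)).
Proof.
move=> t; apply: continuous_comp; last exact: continuous_cos.
by apply: cvgM; [exact: cvg_cst|exact: cvg_id].
Qed.

Lemma measurable_cos_gt (c x : R) : measurable ([set t : R | (x < cos (c * t))%R] : set L).
Proof.
have := continuous_leb_measurable (@continuous_cosM c).
move=> /(_ measurableT [set` `]x, +oo[] (measurable_itv _)); rewrite setTI.
by congr (measurable _); apply/seteqP; split => t /=; rewrite in_itv/= andbT.
Qed.

Lemma cos_gt_near (eta x : R) : (0 < eta < pi)%R -> (0 <= x <= 2 * pi)%R ->
  (cos eta < cos x)%R -> (x < eta \/ 2 * pi - eta < x)%R.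
Proof.
move=> /andP[e0 e1] /andP[x0 x1] h.
have [xe|xe] := ltP x eta; [by left|right].
rewrite ltNge; apply/negP => h2.
have [xp|xp] := leP x pi.
  by move: h; rewrite ltr_cos ?in_itv//=; lra.
have : (cos eta < cos (2 * pi - x))%R.
  by rewrite mulr_natl cosB cos2pi sin2pi mul1r mul0r addr0.
by rewrite ltr_cos ?in_itv//=; lra.
Qed.

(** Within [circle] the set lies in balls of radius eta / n around the points 2 pi j / n. Both 0 and
    2 pi count as centres, hence n + 1 balls, of total length 2 eta (n + 1) / n <= 4 eta, whatever n
    is. *)
Lemma leb_cos_gt (n : nat) (eta : R) : (0 < n)%N -> (0 < eta < pi)%R ->
  leb R (circle `&` [set t : R | (cos eta < cos (n%:R * t))%R]) <= (4 * eta)%:E.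
Proof.
move=> n0 /[dup] etap /andP[e0 e1].
have nR : (0 < n%:R :> R)%R by rewrite ltr0n.
have p0 : (0 < pi :> R)%R by exact: pi_gt0.
pose c (j : nat) : R := (2 * pi * j%:R / n%:R)%R.
have key (t : R) (i : nat) : (`|n%:R * t - i%:R * (2 * pi)| < eta)%R ->
    ball (c i) (eta / n%:R)%R t.
  have E : (t - c i = (n%:R * t - i%:R * (2 * pi)) / n%:R)%R.
    by rewrite /c; field; rewrite gt_eqF.
  by move=> h; rewrite /ball/= distrC E normrM normfV (gtr0_norm nR) ltr_pM2r ?invr_gt0.
have inb (t : R) (i : nat) : (i < n.+1)%N -> ball (c i) (eta / n%:R)%R t ->
    (\big[setU/set0]_(j < n.+1) ball (c j) (eta / n%:R)%R) t.
  by move=> i1 i2; rewrite -(bigcup_mkord _ (fun j => ball (c j) (eta / n%:R)%R)); exists i.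
apply: (@le_trans _ _ (leb R (\big[setU/set0]_(j < n.+1) ball (c j) (eta / n%:R)%R))).
  apply: le_outer_measure => t [] /=; rewrite /circle/= => /andP[t0 t1] ct.
  set j := Num.truncn (n%:R * t / (2 * pi)).
  have nt0 : (0 <= n%:R * t / (2 * pi))%R by rewrite divr_ge0// ?mulr_ge0// ltW.
  have /andP[j1 j2] := truncn_itv nt0; rewrite -/j in j1 j2.
  rewrite ler_pdivlMr ?mulr_gt0// in j1; rewrite ltr_pdivrMr ?mulr_gt0// in j2.
  rewrite -natr1 mulrDl mul1r in j2.
  have jn : (j < n)%N.
    rewrite -(@ltr_nat R) -(@ltr_pM2r _ (2 * pi)%R) ?mulr_gt0//.
    by apply: le_lt_trans j1 _; rewrite ltr_pM2l.
  have : (cos eta < cos (n%:R * t - j%:R * (2 * pi)))%R.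
    have := congr1 (fun z : R[i] => complex.Re z) (expi_periodic_nat (n%:R * t - j%:R * (2 *
        pi)) j).
    by rewrite /expi/= subrK => <-.
  move=> /(cos_gt_near etap) [|h|h]; first by apply/andP; lra.
    by apply: (inb t j); [exact: ltnW|apply: key; rewrite ltr_norml; apply/andP; lra].
  apply: (inb t j.+1) => //; apply: key; rewrite -natr1 mulrDl mul1r ltr_norml.
  by apply/andP; lra.
apply: le_trans.
  exact: (outer_measure_subadditive (wlength idfun)^*%mu (fun j => ball (c j) (eta / n%:R)%R)
      n.+1).
have en0 : (0 <= eta / n%:R)%R by rewrite divr_ge0// ltW.
rewrite (eq_bigr (fun _ => ((eta / n%:R) *+ 2)%:E)); last first.
  by move=> j _; exact: (lebesgue_measure_ball (c j) en0).
rewrite sumEFin lee_fin sumr_const card_ord -[leLHS]mulr_natr -natr1.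
have -> : ((eta / n%:R) *+ 2 * (n%:R + 1) = 2 * eta + 2 * (eta / n%:R))%R.
  by field; rewrite gt_eqF.
have : (eta / n%:R <= eta)%R.
  by rewrite ler_pdivrMr// ler_peMr ?ler1n// ltW.
lra.
Qed.

End exceptional_set.

Section concentration.
Context {R : realType}.
Local Notation L := (lebType R).
Local Open Scope ereal_scope.

Lemma near_at_left_exists (P : R -> Prop) (c b : R) : (b < c)%R ->
  (\forall r \near c^'-, P r) -> exists2 a : R, (b < a < c)%R & forall r, (a <= r < c)%R -> P r.
Proof.
move=> bc [e /= e0 H].
exists (Num.max ((b + c) / 2) (c - e / 2))%R.
  rewrite lt_max gt_max; apply/andP; split; [apply/orP; left; lra|].
  by apply/andP; split; lra.
move=> r /andP[]; rewrite ge_max => /andP[r1 r2] r3; apply: H => //.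
by rewrite /ball/= ltr_norml; apply/andP; split; lra.
Qed.

(** Positivity of [lambda r] is forced by the limit: a negative value reverses the orientation and
    makes the integral nonpositive, and a zero value leaves a one-point interval. *)
Lemma concentration (phi : R -> R -> R) (lambda : R -> R)
  (phi_measurable : forall r, (0 < r < 1)%R -> leb_measurable_fun (phi r))
  (phi_ge0 : forall r, (0 < r < 1)%R -> forall t, (0 <= phi r t)%R)
  (phi_lambda :
    limf_esup (fun delta : R =>
      limf_einf (fun r : R =>
        (oriented_integral (phi r) (- (delta * lambda r)) (delta * lambda r))%:E)
        (1 : R)^'-)
      (0 : R)^'+ = 1%:E) (delta eps : R) : (0 < delta)%R -> (0 < eps < 1)%R ->
  \forall r \near (1 : R)^'-, (0 < lambda r)%R /\
    (1 - eps)%:E <= \int[leb R]_(t in [set` `[(- (delta * lambda r))%R, (delta * lambda r)%R]])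
        (phi r t)%:E.
Proof.
move=> d0 /andP[e0 e1].
pose F (d : R) := limf_einf (fun r : R =>
        (oriented_integral (phi r) (- (d * lambda r)) (d * lambda r))%:E) (1 : R)^'-.
have : (1 - eps)%:E < ereal_sup (F @` [set x : R | (0 < x < delta)%R]).
  apply: (@lt_le_trans _ _ 1%:E); first by rewrite lte_fin ltrBlDr ltrDl.
  rewrite -phi_lambda limf_esupE; apply: ereal_inf_lbound;
      exists [set x : R | (0 < x < delta)%R] => //.
  exists delta => //= x h x0; rewrite x0/=; move: h; rewrite /ball_/= sub0r normrN => h.
  by apply: le_lt_trans h; exact: ler_norm.
move=> /ereal_sup_gt[_ [d /= /andP[d1 d2] <-]].
rewrite /F limf_einfE => /ereal_sup_gt[_ [A A1 <-]] hA.
have r01 : \forall r \near (1 : R)^'-, (0 < r < 1)%R.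
  near=> r; apply/andP; split; near: r; [exact: nbhs_left_gt|exact: nbhs_left_lt].
near=> r.
have r1 : (0 < r < 1)%R by near: r.
have Ar : A r by near: r.
have mI := @leb_measurable_itv R.
have mphi : measurable_fun [set: L] (fun t : L => (phi r t)%:E).
  by apply/measurable_EFinP; exact: phi_measurable.
have p0 t : 0 <= (phi r t)%:E by rewrite lee_fin; exact: phi_ge0.
have : (1 - eps)%:E < (oriented_integral (phi r) (- (d * lambda r)) (d * lambda r))%:E.
  by apply: (lt_le_trans hA); apply: ereal_inf_lbound; exists r.
rewrite lte_fin /oriented_integral.
case: ifPn => [h|]; last first.
  move=> _ H; exfalso; move: H; rewrite ltNge => /negP; apply.
  rewrite (@le_trans _ _ 0%R)//; last by rewrite subr_ge0 ltW.
  by rewrite oppr_le0 /Rintegral fine_ge0// integral_ge0.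
rewrite /Rintegral => H.
have lam0 : (0 <= lambda r)%R.
  have : (0 <= d * lambda r)%R by lra.
  by rewrite pmulr_rge0.
have lamP : (0 < lambda r)%R.
  rewrite lt_neqAle lam0 andbT; apply/eqP => l0; move: H.
  have m0 : measurable ([set 0%R] : set L).
    by apply: leb_borel_measurable; exact: measurable_set1.
  have n0 : leb R [set 0%R] = 0 by rewrite leb_borelE lebesgue_measure_set1.
  rewrite -l0 mulr0 oppr0 set_itv1.
  rewrite (ge0_negligible_integral m0 m0 (measurable_funTS mphi) (fun t _ => p0 t) n0).
  by rewrite setDv integral_set0/=; lra.
split => //.
have : (1 - eps)%:E <= \int[leb R]_(t in [set` `[(- (d * lambda r))%R, (d * lambda r)%R]]) (phi
    r t)%:E.
  move: H; have := @integral_ge0 _ _ _ (leb R) [set` `[(- (d * lambda r))%R, (d * lambda r)%R]]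
      _ (fun t _ => p0 t).
  (* The oriented integral is [fine] of this extended integral; for an infinite value the claimed
     bound is trivial. *)
  case: (\int[_]_(_ in _) _) => [x||] //= _; first by rewrite lee_fin => /ltW.
  by rewrite leey.
move=> /le_trans; apply; apply: ge0_subset_integral.
- exact: mI.
- exact: mI.
- exact: measurable_funTS.
- by move=> t _; exact: p0.
move=> t /=; rewrite !in_itv/= => /andP[h1 h2].
have h3 : (d * lambda r <= delta * lambda r)%R by rewrite ler_wpM2r// ltW.
by rewrite (le_trans h2 h3) andbT; apply: le_trans h1; rewrite lerN2.
Unshelve. all: by end_near. Qed.

End concentration.

(** * One stage of the construction *)

(* [order] and [radius] describe the k-th factor [moebius radius (z ^+ order)], and
   [width] is the half-angle around the roots of unity outside which it is close to 1.
   The values of r used at this stage lie below [time], sets of measure below [budget]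
   are negligible for these r, and [lip] is a Lipschitz constant of the partial product
   up to this factor. *)
Record stage (R : realType) := Stage {
  order : nat; radius : R; width : R; time : R; budget : R; lip : R }.

Section stages.
Context {R : realType}.
Local Notation L := (lebType R).
Local Notation C := R[i].
Local Notation nc := (@ComplexField.Normc.normc R).
Local Notation eps k := ((2^-1 : R) ^+ k).

Definition valid (s : stage R) := 0 < budget s /\ 0 <= lip s.

(** The last clause is what [moebius_far] needs to give |1 - b_k| <= eps k outside the arcs; cosines
    describe the arcs without reduction modulo 2 pi. The bound on [1 - radius] serves the Blaschke
    condition. *)
Definition good_factor k (s : stage R) :=
  [/\ (0 < order s)%N, 0 < radius s < 1, 1 - radius s <= eps k.+1, 0 < width s <= 1 &
    forall x, cos x <= cos (width s) -> 4 * (1 - radius s) <= eps k * nc (1 - expi x)].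

Definition negligible_below (phi : R -> R -> R) k (s : stage R) :=
  forall r, 0 < r < time s -> forall e : set L, measurable e -> e `<=` circle ->
    (leb R e < (budget s)%:E)%E -> (\int[leb R]_(t in e) (phi r t)%:E < (eps k)%:E)%E.

(** In the phase [order s] times t, shifts ranging over [2 pi, 5 pi] carry every point both to a
    multiple of 2 pi and to an odd multiple of pi. The half-width [a] is so small that around a root
    of unity b_k stays within eps k of -1. *)
Definition reaches (phi : R -> R -> R) (lambda : R -> R) k (s : stage R) :=
  forall x, 2 * pi / (order s)%:R <= x <= 5 * pi / (order s)%:R ->
    exists r, [/\ 1 - eps k < r < 1, 0 < r < time s, lambda r = x &
      let a := (1 - radius s) * eps k / 8 / (order s)%:R in
      ((1 - eps k)%:E <= \int[leb R]_(t in [set` `[(- a)%R, a%R]]) (phi r t)%:E)%E].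

(** Arcs of half-angle [width] have measure at most 4 [width]; as budgets halve, the arcs of all
    later stages together measure at most half of [budget s]. In [lip] the 4 is 2 from [expi_lip]
    times 2 from [moebius_lip]. The radius 7 pi / n covers a shift of at most 5 pi / n and a kernel
    window of at most 2 pi / n. *)
Definition next (phi : R -> R -> R) (lambda : R -> R) k (s s' : stage R) :=
  [/\ good_factor k s', negligible_below phi k s', reaches phi lambda k s' &
    [/\ 4 * width s' <= budget s / 4, budget s' <= budget s / 2,
      lip s' = lip s + 4 * (order s')%:R / (1 - radius s') &
      lip s * (7 * pi / (order s')%:R) <= eps k]].

Lemma eps_gt0 k : 0 < eps k. Proof. by rewrite exprn_gt0// invr_gt0. Qed.

Lemma eps_le1 k : eps k <= 1.
Proof. by rewrite exprn_ile1// ?invr_ge0// invf_le1// ler1n. Qed.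

Lemma factor_exists k (w : R) : 0 < w <= 1 ->
  exists2 rho : R, 0 < rho < 1 /\ 1 - rho <= eps k.+1 &
    forall x, cos x <= cos w -> 4 * (1 - rho) <= eps k * nc (1 - expi x).
Proof.
move=> /andP[w0 w1]; have pi2 := @pi_ge2 R.
have cw : cos w < 1 by rewrite -[ltRHS]cos0 ltr_cos ?in_itv//=; lra.
(* [K] is the chord |1 - expi w|, the least distance to 1 outside the arc. *)
pose K := Num.sqrt (2 - 2 * cos w).
have K0 : 0 < K by rewrite sqrtr_gt0; lra.
have e0 := eps_gt0 k; have e1 := eps_le1 k.
pose u := Num.min (eps k.+1) (eps k * K / 4).
have u0 : 0 < u by rewrite lt_min eps_gt0/= divr_gt0// mulr_gt0.
have u1 : u <= eps k.+1 by rewrite ge_min lexx.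
have u2 : u <= eps k * K / 4 by rewrite ge_min lexx orbT.
exists (1 - u).
  split; last by rewrite subKr.
  by apply/andP; move: u1; rewrite exprS; split; lra.
move=> x cx; rewrite subKr.
have : K <= nc (1 - expi x).
  rewrite -(@ler_pXn2r _ 2) ?nnegrE ?normc_ge0 ?sqrtr_ge0// sqr_normc_1Bexpi sqr_sqrtr; lra.
move=> /(ler_wpM2l (ltW e0)); lra.
Qed.

(** Intermediate values on [r0, 1], where lambda passes from a value at least x to 0; smallness of
    lambda beyond tau forces r < tau. *)
Lemma reach_level (lambda : R -> R) (r0 tau x : R) : {within `[0, 1], continuous lambda} ->
  lambda 1 = 0 -> 0 < r0 < 1 -> 0 < x <= lambda r0 ->
  (forall r, tau <= r < 1 -> `|lambda r| < x) ->
  exists r, [/\ r0 <= r < 1, r < tau & lambda r = x].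
Proof.
move=> cl l1 /andP[r00 r01] /andP[x0 xl] small.
have cr0 : {within `[r0, 1], continuous lambda}.
  apply: continuous_subspaceW cl => y /=; rewrite !in_itv/= => /andP[h1 h2].
  by rewrite h2 (le_trans (ltW r00)).
have x01 : Num.min (lambda r0) (lambda 1) <= x <= Num.max (lambda r0) (lambda 1).
  by rewrite l1 ge_min le_max xl (ltW x0) orbT.
have [r + rx] := IVT (ltW r01) cr0 x01; rewrite in_itv/= => /andP[r0r r1].
have r_lt1 : r < 1.
  by rewrite lt_neqAle r1 andbT; apply/eqP => r1E; move: x0; rewrite -rx r1E l1 ltxx.
exists r; split => //; first by rewrite r0r.
rewrite ltNge; apply/negP => taur; have := small r; rewrite taur r_lt1 rx => /(_ isT).
by rewrite ltNge ler_norm.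
Qed.

Lemma next_exists (phi : R -> R -> R) (lambda : R -> R)
  (phi_measurable : forall r, 0 < r < 1 -> leb_measurable_fun (phi r))
  (phi_ge0 : forall r, 0 < r < 1 -> forall t, 0 <= phi r t)
  (phi_equi : forall eps tau : R, 0 < eps -> 0 < tau < 1 ->
    exists2 delta : R, 0 < delta &
      forall r, 0 < r < tau ->
      forall e : set (lebType R), measurable e -> e `<=` circle ->
        (leb R e < delta%:E)%E -> (\int[leb R]_(t in e) (phi r t)%:E < eps%:E)%E)
  (lambda_cont : {within `[0, 1], continuous lambda})
  (lambda1 : lambda 1 = 0)
  (phi_lambda :
    limf_esup (fun delta : R =>
      limf_einf (fun r : R =>
        (oriented_integral (phi r) (- (delta * lambda r)) (delta * lambda r))%:E)
        (1 : R)^'-)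
      (0 : R)^'+ = 1%:E) k (s : stage R) :
  valid s -> exists2 s', valid s' & next phi lambda k s s'.
Proof.
move=> [d0 l0]; have pi2 := @pi_ge2 R; have p0 := @pi_gt0 R.
have e0 := eps_gt0 k; have e1 := eps_le1 k; have ep0 := eps_gt0 k.+1.
have epE : eps k.+1 = 2^-1 * eps k by rewrite exprS.
(* The 16 is 4 times 4, from the requirement 4 w <= budget / 4. *)
pose w := Num.min 1 (budget s / 16).
have w01 : 0 < w <= 1.
  by rewrite lt_min ge_min lexx ltr01 divr_gt0.
have [rho [/[dup] rho01 /andP[r0 r1] rhoe] rhoP] := factor_exists k w01.
(* [theta] is the half-width of the kernel window in the phase variable n t. *)
pose theta := (1 - rho) * eps k / 8.
have th0 : 0 < theta by rewrite divr_gt0// mulr_gt0// subr_gt0.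
(* At the values used, lambda(r) <= 5 pi / N; the ratio theta / (6 pi) therefore gives a window
   inside theta / N although N is not yet known. *)
have dl0 : 0 < theta / (6 * pi) by rewrite divr_gt0// mulr_gt0.
(* [eps k.+1] replaces [eps k], which equals 1 at k = 0 and is then outside the range allowed in
   [concentration]. *)
have epk : 0 < eps k.+1 < 1 by rewrite epE; apply/andP; split; lra.
have epk1 : 1 - eps k.+1 < 1 by rewrite epE; lra.
have [R1 /andP[R1a R1b] HR1] := near_at_left_exists epk1
  (concentration phi_measurable phi_ge0 phi_lambda dl0 epk).
have [|lamR1 _] := HR1 R1; first by rewrite lexx.
rewrite epE in R1a.
have R10 : 0 < R1 by apply: le_lt_trans R1a; clear -e1; lra.
(* With this [N] every level up to 6 pi / N is reached by lambda on [R1, 1], and the previous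
   partial product is almost constant at the scale 7 pi / N. *)
pose N := (Num.truncn (6 * pi / lambda R1 + lip s * (7 * pi) / eps k)).+1.
have N0 : 0 < N%:R :> R by rewrite ltr0n.
have NP : 6 * pi / lambda R1 + lip s * (7 * pi) / eps k < N%:R by exact: truncnS_gt.
have q1 : 0 < 6 * pi / lambda R1 by rewrite divr_gt0// mulr_gt0.
have q2 : 0 <= lip s * (7 * pi) / eps k by rewrite divr_ge0 ?mulr_ge0// ltW.
have NP1 : 6 * pi / N%:R < lambda R1.
  rewrite ltr_pdivrMr// [ltRHS]mulrC -ltr_pdivrMr//; apply: le_lt_trans NP.
  by rewrite lerDl.
have NP2 : lip s * (7 * pi / N%:R) <= eps k.
  rewrite mulrA ler_pdivrMr// [leRHS]mulrC -ler_pdivrMr//; apply: le_trans (ltW NP).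
  by rewrite lerDr ltW.
have t0 : 0 < 2 * pi / N%:R :> R by rewrite divr_gt0// mulr_gt0.
have [lc1 lc2 lc3] := (continuous_within_itvP lambda ltr01).1 lambda_cont.
have nl : \forall r \near (1 : R)^'-, `|lambda r| < 2 * pi / N%:R.
  move/cvgrPdist_lt : lc3 => /(_ _ t0); rewrite lambda1.
  by apply: filterS => r; rewrite sub0r normrN.
(* Beyond [tau] lambda stays below 2 pi / N, so every shift of this stage is attained before [tau],
   where the equicontinuity assumption applies. *)
have [tau /andP[tauR tau1] Htau] := near_at_left_exists R1b nl.
have tau01 : 0 < tau < 1 by rewrite tau1 (lt_trans R10).
have [d' d'0 d'P] := phi_equi _ _ e0 tau01.
exists (Stage N rho w tau (Num.min d' (budget s / 2)) (lip s + 4 * N%:R / (1 - rho))).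
  split; rewrite /=; first by rewrite lt_min d'0 divr_gt0.
  by rewrite addr_ge0// divr_ge0 ?mulr_ge0 ?ler0n// subr_ge0 ltW.
split.
- by split.
- move=> r /= rt e me ec; rewrite /= EFin_min lt_min => /andP[h _]; exact: d'P.
- move=> x /= /andP[x1 x2].
  have xR1 : 0 < x <= lambda R1.
    rewrite (lt_le_trans t0)//= (le_trans x2)// (le_trans _ (ltW NP1))//.
    by rewrite !ler_wpM2r ?invr_ge0 ?ler0n ?(ltW p0)// ler_nat.
  have R101 : 0 < R1 < 1 by rewrite R10.
  have small r : tau <= r < 1 -> `|lambda r| < x by move=> /Htau /lt_le_trans; exact.
  have [r [/andP[rR r1'] rt rx]] := reach_level lambda_cont lambda1 R101 xR1 small.
  have rk : 1 - eps k < r by apply: le_lt_trans (lt_le_trans R1a rR); clear -e0; lra.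
  have r0' : 0 < r by exact: lt_le_trans rR.
  exists r; split => //=; [by rewrite rk|by rewrite r0'|].
  have [|_ /le_trans H] := HR1 r; first by rewrite rR.
  have r01 : 0 < r < 1 by rewrite r0'.
  have mphi : measurable_fun [set: L] (fun t : L => (phi r t)%:E).
    by apply/measurable_EFinP; exact: phi_measurable.
  apply: (@le_trans _ _ (1 - eps k.+1)%:E); first by rewrite lee_fin lerD2l lerN2 epE;
      clear -e0; lra.
  apply: H; apply: ge0_subset_integral.
  + exact: leb_measurable_itv.
  + exact: leb_measurable_itv.
  + exact: measurable_funTS.
  + by move=> t _; rewrite lee_fin; exact: phi_ge0.
  have h : theta / (6 * pi) * lambda r <= theta / N%:R.
    rewrite rx; apply: (@le_trans _ _ (theta / (6 * pi) * (5 * pi / N%:R))).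
      by rewrite ler_wpM2l// ltW.
    have -> : theta / (6 * pi) * (5 * pi / N%:R) = 5 / 6 * (theta / N%:R).
      have pn : (pi : R) != 0 by rewrite gt_eqF.
      have Nn : N%:R != 0 :> R by rewrite gt_eqF.
      have gen (u p M : R) : p != 0 -> M != 0 -> u / (6 * p) * (5 * p / M) = 5 / 6 * (u / M).
        by move=> p_neq0 M_neq0; field; rewrite p_neq0 M_neq0.
      exact: gen.
    have : 0 < theta / N%:R by rewrite divr_gt0.
    by clear; lra.
  move=> t /=; rewrite !in_itv/= -/theta => /andP[h1 h2].
  by apply/andP; split; [apply: le_trans h1; rewrite lerN2|exact: le_trans h2 h].
- split => //=.
    have : w <= budget s / 16 by rewrite ge_min lexx orbT.
    by clear; lra.
  by rewrite ge_min lexx orbT.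
Qed.

End stages.

(** * Averages against the kernel *)

Section kernel.
Context {R : realType}.
Local Notation L := (lebType R).
Local Open Scope ereal_scope.

Lemma circleE : circle = [set` `[0%R, (2 * pi)%R[] :> set R.
Proof. by apply/seteqP; split => t; rewrite /circle/= in_itv. Qed.

Lemma measurable_circle : measurable (@circle R).
Proof. by rewrite circleE; exact: leb_measurable_itv. Qed.

Lemma twopi_gt0 : (0 < 2 * pi :> R)%R.
Proof. by rewrite mulr_gt0// pi_gt0. Qed.

Section average.
Variables (D : set L) (psi f : L -> R) (v M delta : R).
Hypotheses (mD : measurable D) (mpsi : measurable_fun setT psi)
  (mf : measurable_fun setT f) (psi0 : forall t, (0 <= psi t)%R)
  (psi1 : \int[leb R]_(t in D) (psi t)%:E = 1) (fM : forall t, (`|f t| <= M)%R)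
  (near : \int[leb R]_(t in D) (psi t * `|f t - v|)%:E <= delta%:E).

Lemma Rintegral_average_near : (`|\int[leb R]_(t in D) (psi t * f t) - v| <= delta)%R.
Proof.
have ipsi : (leb R).-integrable D (EFin \o psi).
  apply/integrableP; split; first by apply/measurable_EFinP; exact: measurable_funTS.
  under eq_integral => t _ do rewrite /= ger0_norm//.
  by rewrite psi1 ltry.
have mpf : measurable_fun setT (fun t => (psi t * f t)%R) by exact: measurable_funM.
have ipf : (leb R).-integrable D (EFin \o (fun t => psi t * f t)%R).
  apply: (@le_integrable _ _ _ _ _ mD _ (EFin \o (fun t => M * psi t)%R)).
  - by apply/measurable_EFinP; exact: measurable_funTS.
  - move=> t _ /=; rewrite lee_fin !normrM mulrC (ger0_norm (psi0 t)).
    by rewrite ler_wpM2r// (le_trans (fM t))// ler_norm.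
  - exact: (integrableZl mD M ipsi).
have ipv : (leb R).-integrable D (EFin \o (fun t => v * psi t)%R).
  exact: (integrableZl mD v ipsi).
have vE : v = (\int[leb R]_(t in D) (v * psi t))%R.
  by rewrite RintegralZl// /Rintegral psi1/= mulr1.
rewrite [X in (`|_ - X|)%R]vE -RintegralB//.
apply: (le_trans (le_normr_Rintegral _ _)) => //.
  by have := integrableB mD ipf ipv; apply: eq_integrable => // t _ /=; rewrite ?EFinB.
rewrite /Rintegral.
have E : \int[leb R]_(t in D) (`|psi t * f t - v * psi t|)%:E =
    \int[leb R]_(t in D) (psi t * `|f t - v|)%:E.
  apply: eq_integral => t _; congr EFin.
  by rewrite [(v * _)%R]mulrC -mulrBr normrM ger0_norm.
rewrite E -lee_fin fineK//.
rewrite ge0_fin_numE; first exact: le_lt_trans near (ltry _).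
by apply: integral_ge0 => t _; rewrite lee_fin mulr_ge0.
Qed.

End average.

Lemma indic_eqP (T T' : Type) (A : set T) (B : set T') x y : A x = B y -> \1_A x = \1_B y :> R.
Proof.
move=> AB; rewrite !indicE; congr (nat_of_bool _)%:R.
by apply/idP/idP => /set_mem h; apply/mem_set; move: h; rewrite AB.
Qed.

Lemma EFin_indicM (D A : set L) (g : L -> R) :
  \int[leb R]_(t in D) (g t * \1_A t)%:E = \int[leb R]_(t in D `&` A) (g t)%:E.
Proof.
rewrite integral_mkcondr; apply: eq_integral => t _.
by rewrite /patch indicE; case: (t \in A); rewrite ?mulr1 ?mulr0.
Qed.

Lemma ge0_integral_comb (D : set L) (f1 f2 f3 : L -> R) (c1 c2 c3 : R) :
  measurable D -> measurable_fun setT f1 -> measurable_fun setT f2 -> measurable_fun setT f3 ->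
  (forall t, 0 <= f1 t)%R -> (forall t, 0 <= f2 t)%R -> (forall t, 0 <= f3 t)%R ->
  (0 <= c1)%R -> (0 <= c2)%R -> (0 <= c3)%R ->
  \int[leb R]_(t in D) (c1 * f1 t + c2 * f2 t + c3 * f3 t)%:E =
  c1%:E * \int[leb R]_(t in D) (f1 t)%:E + c2%:E * \int[leb R]_(t in D) (f2 t)%:E
    + c3%:E * \int[leb R]_(t in D) (f3 t)%:E.
Proof.
move=> mD m1 m2 m3 p1 p2 p3 q1 q2 q3.
have mE (f : L -> R) : measurable_fun setT f -> measurable_fun D (EFin \o f).
  by move=> mf; apply/measurable_EFinP; exact: measurable_funTS.
have mZ (c : R) (f : L -> R) : measurable_fun setT f -> measurable_fun D (fun t => c%:E * (f
    t)%:E).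
  by move=> mf; apply: emeasurable_funM; [exact: measurable_cst|exact: mE].
have pZ (c : R) (f : L -> R) t : (0 <= c)%R -> (forall t, 0 <= f t)%R -> D t -> 0 <= c%:E * (f
    t)%:E.
  by move=> c0 f0 _; rewrite -EFinM lee_fin mulr_ge0.
have Z (c : R) (f : L -> R) : measurable_fun setT f -> (0 <= c)%R -> (forall t, 0 <= f t)%R ->
    \int[leb R]_(t in D) (c%:E * (f t)%:E) = c%:E * \int[leb R]_(t in D) (f t)%:E.
  move=> mf c0 f0.
  have pf t : D t -> 0 <= (f t)%:E by move=> _; rewrite lee_fin; exact: f0.
  exact: (ge0_integralZl_EFin _ mD pf (mE _ mf) c0).
rewrite -!Z// -(ge0_integralD _ mD _ (mZ _ _ m1) _ (mZ _ _ m2)); last 2 first.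
- by move=> t; exact: pZ.
- by move=> t; exact: pZ.
rewrite -(ge0_integralD _ mD _ (emeasurable_funD (mZ _ _ m1) (mZ _ _ m2)) _ (mZ _ _ m3)).
- by apply: eq_integral => t _; rewrite !EFinD !EFinM.
- by move=> t Dt; rewrite adde_ge0// pZ.
- by move=> t; exact: pZ.
Qed.

(** The integrand is the majorant found in [pointwise_near]. The constant contributes 3 ep by total
    mass 1, the set A contributes 3 ep by smallness, and the complement of the window contributes 2
    ep by concentration. *)
Lemma integral_kernel_le (g : R -> R) (y a ep : R) (A : set R) :
  leb_measurable_fun g -> periodic g (2 * pi)%R -> (forall t, (0 <= g t)%R) ->
  \int[leb R]_(t in circle) (g t)%:E = 1 ->
  measurable (A : set L) -> (forall t, A (t + 2 * pi)%R = A t) ->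
  (0 <= ep)%R -> (0 < a < pi)%R ->
  (1 - ep)%:E <= \int[leb R]_(t in [set` `[(- a)%R, a%R]]) (g t)%:E ->
  (forall e : set L, measurable e -> e `<=` circle -> leb R e = leb R (circle `&` A) ->
    \int[leb R]_(t in e) (g t)%:E <= ep%:E) ->
  \int[leb R]_(t in circle) (g (y - t) * (3 * ep + 3 * \1_A t +
     2 * \1_[set u | (cos u < cos a)%R] (y - t)))%:E <= (8 * ep)%:E.
Proof.
move=> mg perg g0 g1 mA perA ep0 /andP[a0 ap] conc small.
have pp := twopi_gt0.
have mC := measurable_circle.
have mr : measurable_fun setT ((fun t : R => y - t)%R : L -> L) by exact: measurable_reflect.
have mgy : measurable_fun [set: L] ((fun t : R => g (y - t)%R) : L -> R).
  exact: (measurableT_comp (mg : measurable_fun [set: L] (g : L -> R)) mr).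
(* The complement of the window modulo 2 pi, written by a cosine so as to be periodic. *)
pose Bad : set R := [set u | (cos u < cos a)%R].
have mBad : measurable (Bad : set L).
  have := continuous_leb_measurable (@continuous_cos R).
  move=> /(_ measurableT [set` `]-oo, (cos a)%R[] (measurable_itv _)); rewrite setTI.
  by congr (measurable _); apply/seteqP; split => t /=; rewrite in_itv.
have perBad t : Bad (t + 2 * pi)%R = Bad t.
  by rewrite /Bad/= mulr_natl cosD2pi.
have mgE D : measurable_fun (D : set L) (fun t : L => (g t)%:E).
  by apply/measurable_EFinP; exact: measurable_funTS.
have mind (S : set R) : measurable (S : set L) -> measurable_fun [set: L] (\1_S : L -> R).
  by move=> mS; exact: measurable_indic.
have refl (S : set R) : measurable (S : set L) -> (forall t, S (t + 2 * pi)%R = S t) ->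
    \int[leb R]_(t in circle) (g (y - t) * \1_S (y - t))%:E =
    \int[leb R]_(t in circle `&` S) (g t)%:E.
  move=> mS pS; rewrite -EFin_indicM circleE.
  apply: (@integral_periodic_reflect R (2 * pi)%R (fun t : R => (g t * \1_S t)%:E) pp).
  - by apply/measurable_EFinP; apply: measurable_funM; [exact: mg|exact: mind].
  - by move=> t; rewrite lee_fin mulr_ge0// indicE ler0n.
  - by move=> t; rewrite perg; congr (_ * _)%:E; apply: indic_eqP; exact: pS.
have i1 : \int[leb R]_(t in circle) (g (y - t))%:E = 1.
  have := refl setT measurableT (fun t => erefl); rewrite setIT g1 => <-.
  by apply: eq_integral => t _; rewrite indicT mulr1.
have iBad : \int[leb R]_(t in circle) (g (y - t) * \1_Bad (y - t))%:E <= ep%:E.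
  rewrite refl//.
  have split1 : \int[leb R]_(t in circle `&` Bad) (g t)%:E + \int[leb R]_(t in circle `&` ~`
      Bad) (g t)%:E = 1.
    rewrite -g1 -ge0_integral_setU//.
    - by rewrite -setIUr setUv setIT.
    - exact: measurableI.
    - by apply: measurableI => //; exact: measurableC.
    - by move=> t _; rewrite lee_fin.
    - by apply/disj_setPS => t [[_ h] [_]].
  (* The window lies in the period [-pi, pi[ and avoids [Bad], so the mass left for [Bad] is at most
     ep. *)
  have low : (1 - ep)%:E <= \int[leb R]_(t in circle `&` ~` Bad) (g t)%:E.
    apply: (le_trans conc).
    have -> : \int[leb R]_(t in circle `&` ~` Bad) (g t)%:E =
        \int[leb R]_(t in [set` `[(- pi)%R, (- pi + 2 * pi)%R[] `&` ~` Bad) (g t)%:E.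
      rewrite -!EFin_indicM.
      rewrite circleE; symmetry.
      apply: (@integral_periodic R (2 * pi)%R (fun t : R => (g t * \1_(~` Bad) t)%:E) pp).
      - apply/measurable_EFinP; apply: measurable_funM; first exact: mg.
        by apply: mind; exact: measurableC.
      - by move=> t; rewrite lee_fin mulr_ge0// indicE ler0n.
      - by move=> t; rewrite perg; congr (_ * _)%:E; apply: indic_eqP; rewrite /= perBad.
    apply: ge0_subset_integral => //.
    - exact: leb_measurable_itv.
    - by apply: measurableI; [exact: leb_measurable_itv|exact: measurableC].
    - by move=> t _; rewrite lee_fin.
    - move=> t /=; rewrite !in_itv/= => /andP[t1 t2]; split; first by apply/andP; split; lra.
      rewrite /Bad/=; apply/negP; rewrite -leNgt -[cos t]cos_norm.
      have ta : (`|t| <= a)%R by rewrite ler_norml t1.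
      move: ta; rewrite le_eqVlt => /orP[/eqP->//|ta].
      have n0 : (0 <= `|t|)%R by exact: normr_ge0.
      by apply: ltW; rewrite ltr_cos// in_itv/=; apply/andP; split => //; lra.
  have gb0 : 0 <= \int[leb R]_(t in circle `&` Bad) (g t)%:E.
    by apply: integral_ge0 => t _; rewrite lee_fin.
  move: split1 low gb0.
  case: (\int[leb R]_(t in _ `&` Bad) _) => [u||]//; case: (\int[leb R]_(t in _) _) => [w||]//=.
  by rewrite -EFinD !lee_fin => -[]; lra.
have iA : \int[leb R]_(t in circle) (g (y - t) * \1_A t)%:E <= ep%:E.
  (* The kernel is evaluated at y - t, so smallness is applied to the reflection of A, which by
     periodicity has the same measure within [circle]. *)
  pose A' : set R := [set u | A (y - u)%R].
  have mA' : measurable (A' : set L).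
    by have := mr measurableT A mA; rewrite setTI.
  have pA' t : A' (t + 2 * pi)%R = A' t.
    by rewrite /A'/= -(perA (y - (t + 2 * pi))%R); congr A; ring.
  have -> : \int[leb R]_(t in circle) (g (y - t) * \1_A t)%:E =
      \int[leb R]_(t in circle `&` A') (g t)%:E.
    rewrite -refl//; apply: eq_integral => t _; congr (_ * _)%:E.
    by apply: indic_eqP; rewrite /A'/= subKr.
  apply: small => //; first exact: measurableI.
  rewrite !(setIC circle) -!integral_indic// circleE.
  have mA1 : measurable_fun [set: L] (EFin \o (\1_A : L -> R)).
    by move/measurable_EFinP : (mind _ mA).
  have pA1 t : 0 <= (\1_A t)%:E :> \bar R by rewrite lee_fin indicE ler0n.
  have perA1 (t : R) : (\1_A (t + 2 * pi)%R)%:E = (\1_A t)%:E :> \bar R.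
    by congr EFin; apply: indic_eqP; exact: perA.
  by rewrite -[RHS](@integral_periodic_reflect R (2 * pi)%R _ pp mA1 pA1 perA1 y).
have ind0 (S : set R) t : (0 <= \1_S t :> R)%R by rewrite indicE ler0n.
have gi0 (S : set R) t u : (0 <= g t * \1_S u)%R by exact: mulr_ge0.
have mT : measurable_fun [set: L] (fun t : L => g (y - t) * \1_A t)%R.
  by apply: measurable_funM; [exact: mgy|exact: mind].
have mB : measurable_fun [set: L] (fun t : L => g (y - t) * \1_Bad (y - t))%R.
  by apply: measurable_funM; [exact: mgy|exact: (measurableT_comp (mind _ mBad) mr)].
have ep3 : (0 <= 3 * ep)%R by exact: mulr_ge0.
have := @ge0_integral_comb circle _ _ _ (3 * ep)%R 3%R 2%R mC mgy mT mB
  (fun t => g0 (y - t)%R) (fun t => gi0 A _ _) (fun t => gi0 Bad _ _) ep3 (ler0n _ _) (ler0n _ _).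
have -> : \int[leb R]_(t in circle) (g (y - t) * (3 * ep + 3 * \1_A t + 2 * \1_Bad (y - t)))%:E =
    \int[leb R]_(t in circle) (3 * ep * g (y - t) + 3 * (g (y - t) * \1_A t)
      + 2 * (g (y - t) * \1_Bad (y - t)))%:E.
  by apply: eq_integral => t _; congr EFin; ring.
move=> ->.
rewrite i1 mule1.
have -> : (8 * ep = 3 * ep + 3 * ep + 2 * ep)%R by ring.
rewrite !EFinD; apply: leeD; first apply: leeD => //.
  by rewrite [X in _ <= X]EFinM; apply: lee_wpmul2l => //; rewrite lee_fin.
by rewrite [X in _ <= X]EFinM; apply: lee_wpmul2l => //; rewrite lee_fin.
Qed.
End kernel.

(** * The infinite product *)

Section product.
Context {R : realType}.
Local Open Scope complex_scope.
Local Notation L := (lebType R).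
Local Notation C := R[i].
Local Notation nc := (@ComplexField.Normc.normc R).
Local Notation eps k := ((2^-1 : R) ^+ k).
Variable S : nat -> stage R.
Local Notation n k := (order (S k.+1)).
Local Notation rho k := (radius (S k.+1)).
Hypotheses (S0 : lip (S 0%N) = 0) (Sgood : forall k, good_factor k (S k.+1))
  (Svalid : forall k, valid (S k))
  (Swidth : forall k, 4 * width (S k.+1) <= budget (S k) / 4)
  (Sbudget : forall k, budget (S k.+1) <= budget (S k) / 2)
  (Slip : forall k, lip (S k.+1) = lip (S k) + 4 * (n k)%:R / (1 - rho k)).

Definition factor k (t : R) : C := moebius (rho k) (expi ((n k)%:R * t)).
Definition partial K (t : R) : C := \prod_(0 <= j < K) factor j t.
(** The partial products may diverge on a null set. Upper limits of the coordinates give a function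
    that is bounded, periodic and measurable on the whole line and agrees with the limit wherever
    the limit exists. *)
Definition product (t : R) : C :=
  limn_sup (fun K => complex.Re (partial K t)) +i* limn_sup (fun K => complex.Im (partial K t)).
(** Only factors after the k-th count: off this set each of them is within eps j of 1. The sets
    decrease with k to a null set. *)
Definition exceptional k : set R :=
  [set t | exists2 j, (k < j)%N & cos (width (S j.+1)) < cos ((n j)%:R * t)].

Lemma rho01 k : 0 < rho k < 1. Proof. by have [] := Sgood k. Qed.

Lemma normc_factor k t : nc (factor k t) = 1.
Proof.
have /andP[r0 r1] := rho01 k.
by rewrite normc_moebius_eq1 ?normc_expi// ltW.
Qed.

Lemma normc_partial K t : nc (partial K t) = 1.
Proof.
rewrite /partial; elim: K => [|K IH]; first by rewrite big_geq// normc1E.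
by rewrite big_nat_recr//= normcME IH normc_factor mulr1.
Qed.

Lemma factor_periodic k t : factor k (t + 2 * pi) = factor k t.
Proof. by rewrite /factor mulrDr expi_periodic_nat. Qed.

Lemma factor_periodic_int k t (z : int) : factor k (t + z%:~R * (2 * pi)) = factor k t.
Proof.
rewrite /factor mulrDr mulrA; congr moebius.
have -> : (n k)%:R * z%:~R = (Posz (n k) * z)%:~R :> R by rewrite intrM.
by rewrite expi_periodic.
Qed.

Lemma partial_periodic K t : partial K (t + 2 * pi) = partial K t.
Proof. by apply: eq_bigr => j _; exact: factor_periodic. Qed.

Lemma partial_periodic_int K t (z : int) : partial K (t + z%:~R * (2 * pi)) = partial K t.
Proof. by apply: eq_bigr => j _; exact: factor_periodic_int. Qed.

Lemma product_periodic : periodic product (2 * pi).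
Proof.
by move=> t; rewrite /product; congr (_ +i* _); congr limn_sup; apply/funext => K;
  rewrite partial_periodic.
Qed.

Lemma factor_lip k t t' :
  nc (factor k t - factor k t') <= 4 * (n k)%:R / (1 - rho k) * `|t - t'|.
Proof.
have /andP[r0 r1] := rho01 k.
have r1' : 0 < 1 - rho k by rewrite subr_gt0.
rewrite mulrAC ler_pdivlMr//.
have := @moebius_lip _ (rho k) (expi ((n k)%:R * t)) (expi ((n k)%:R * t')).
rewrite !normc_expi ltW// => /(_ isT r1 (lexx _) (lexx _)) /le_trans; apply.
have := expi_lip ((n k)%:R * t) ((n k)%:R * t').
rewrite -mulrBr normrM normr_nat; lra.
Qed.

Lemma partial_lip K t t' : nc (partial K t - partial K t') <= lip (S K) * `|t - t'|.
Proof.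
elim: K => [|K IH]; first by rewrite /partial !big_geq// subrr normc0E S0 mul0r.
rewrite /partial !big_nat_recr//= Slip mulrDl.
apply: le_trans (normcB_mul _ _ _ _) _; [by rewrite normc_partial|by rewrite normc_factor|].
by rewrite lerD ?factor_lip.
Qed.

(* Uniformity in the radial parameter [s] yields both the convergence on the circle
   ([s = 1]) and the radial limits. *)
Lemma factor_far k t (s : R) : ~ cos (width (S k.+1)) < cos ((n k)%:R * t) -> 0 <= s <= 1 ->
  nc (1 - moebius (rho k) (s%:C * expi ((n k)%:R * t))) <= eps k.
Proof.
move=> /negP; rewrite -leNgt => ct s01; have [_ /andP[r0 r1] _ _ /(_ _ ct) H] := Sgood k.
have := @moebius_far _ (rho k) (expi ((n k)%:R * t)) s (ltW r0) r1 (normc_expi _) s01.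
move=> /le_trans /(_ H); rewrite ler_pM2r//.
rewrite lt_neqAle normc_ge0 andbT eq_sym; apply/eqP => E.
by move: H; rewrite E mulr0; lra.
Qed.

Lemma sum_eps_le K M : \sum_(K <= j < M) eps j <= 2 * eps K.
Proof.
have e2 j : 0 <= 2 * eps j by apply: mulr_ge0 => //; exact: ltW (eps_gt0 _).
have [KM|MK] := leqP K M; last by rewrite big_geq ?(ltnW MK).
suff -> : \sum_(K <= j < M) eps j = 2 * eps K - 2 * eps M.
  by rewrite gerBl.
elim: M KM => [|M IH]; first by rewrite leqn0 => /eqP->; rewrite big_geq// subrr.
rewrite leq_eqVlt => /orP[/eqP->|]; first by rewrite big_geq// subrr.
by rewrite ltnS => KM; rewrite big_nat_recr//= IH// [eps M.+1]exprS; field.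
Qed.

(** * Measure of the exceptional sets *)

Lemma exceptional_measurable k : measurable (exceptional k : set L).
Proof.
have -> : exceptional k = \bigcup_(j in [set j | (k < j)%N])
    [set t : R | cos (width (S j.+1)) < cos ((n j)%:R * t)].
  by apply/seteqP; split => t [j h1 h2]; exists j.
by apply: bigcup_measurable => j _; exact: measurable_cos_gt.
Qed.

Lemma exceptional_periodic k t : exceptional k (t + 2 * pi) = exceptional k t.
Proof.
have E j : cos ((n j)%:R * (t + 2 * pi)) = cos ((n j)%:R * t).
  have := congr1 (fun z : R[i] => complex.Re z) (expi_periodic_nat ((n j)%:R * t) (n j)).
  by move=> h; rewrite mulrDr; exact: h.
by apply/propeqP; split => -[j h1 h2]; exists j => //; move: h2; rewrite E.
Qed.

Lemma budget_geometric k i : budget (S (k + i)%N) <= budget (S k) / 2 ^+ i.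
Proof.
elim: i => [|i IH]; first by rewrite addn0 expr0 divr1.
rewrite addnS (le_trans (Sbudget _))// exprSr invfM mulrA.
by rewrite ler_pM2r ?invr_gt0.
Qed.

(** The arcs of the factor k + 1 + i have measure at most 2^-(i + 2) times [budget (S k.+1)], which
    sums to half of that budget. *)
Lemma leb_exceptional k :
  (leb R (circle `&` exceptional k) < (budget (S k.+1))%:E)%E.
Proof.
have [b0 _] := Svalid k.+1.
pose F i : set L := circle `&` [set t : R | cos (width (S (k.+1 + i).+1)) < cos ((n (k.+1 +
    i))%:R * t)].
apply: (@le_lt_trans _ _ (budget (S k.+1) / 2)%:E); last by rewrite lte_fin; lra.
apply: (@le_trans _ _ (leb R (\bigcup_i F i))).
  apply: le_outer_measure => t [ct [j kj h]].
  by exists (j - k.+1)%N => //; split => //; rewrite subnKC.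
apply: (le_trans (outer_measure_sigma_subadditive _ _)).
have b02 : 0 <= budget (S k.+1) / 2 by rewrite divr_ge0// ltW.
apply: (@le_trans _ _ (\sum_(0 <= i <oo) (budget (S k.+1) / 2 / (2 ^ i.+1)%:R)%:E)%E); last first.
  exact: (epsilon_trick0 xpredT b02).
apply: lee_nneseries => [i _ _|i _]; first exact: measure_ge0.
have [n0 _ _ /andP[w0 w1] _] := Sgood (k.+1 + i)%N.
have pi2 := @pi_ge2 R.
apply: le_trans (leb_cos_gt n0 _) _; first by apply/andP; lra.
rewrite lee_fin (le_trans (Swidth _))//.
have := budget_geometric k.+1 i.
rewrite natrX exprS invfM => h.
have -> : budget (S k.+1) / 2 * (2^-1 * (2 ^+ i)^-1) = budget (S k.+1) / 2 ^+ i / 4 by field.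
by rewrite ler_pM2r ?invr_gt0.
Qed.

Lemma factor_far1 k t j : ~ exceptional k t -> (k < j)%N -> nc (1 - factor j t) <= eps j.
Proof.
move=> nE kj; have := @factor_far j t 1; rewrite mul1r; apply.
  by move=> h; apply: nE; exists j.
by rewrite ler01 lexx.
Qed.

Lemma product_cvg k t : ~ exceptional k t ->
  (partial ^~ t : nat -> R[i]^o) @ \oo --> (product t : R[i]^o).
Proof.
move=> nE.
have f1 j : nc (factor j t) <= 1 by rewrite normc_factor.
have e1 : cvgn (series (fun j => eps j)).
  have z1 : `|2^-1 : R| < 1 by rewrite gtr0_norm ?invr_gt0// invf_lt1// ltr1n.
  have := @is_cvg_geometric_series R 1 _ z1.
  have -> // : geometric 1 2^-1 = (fun j => eps j) by apply/funext => j;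
      rewrite /geometric/= mul1r.
(* The first k + 1 factors are not controlled at t, so the sequence is shifted past them. *)
have [|l] := @cvg_summable_variation R (fun j => partial (j + k.+1) t) (fun j => eps j) _ e1.
  move=> j; rewrite addSn; apply: le_trans (prod_step_le _ f1) _.
  apply: le_trans (factor_far1 nE _) _; first by rewrite ltn_addl.
  by rewrite exprD ler_piMr ?(ltW (eps_gt0 _))// eps_le1.
rewrite (cvg_shiftn k.+1 (partial ^~ t : nat -> R[i]^o)) => lP.
move/cvg_ReIm : (lP) => [lR lI].
suff -> : product t = l by [].
have LR : limn_sup (fun K => complex.Re (partial K t)) = complex.Re l.
  by rewrite cvg_limn_supE; [exact/cvg_lim|apply/cvg_ex; exists (complex.Re l)].
have LI : limn_sup (fun K => complex.Im (partial K t)) = complex.Im l.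
  by rewrite cvg_limn_supE; [exact/cvg_lim|apply/cvg_ex; exists (complex.Im l)].
by rewrite /product LR LI; case: (l).
Qed.

Lemma product_tail k t K : ~ exceptional k t -> (k < K)%N ->
  nc (product t - partial K t) <= 2 * eps K.
Proof.
move=> nE kK; apply: (@cvg_normc_le R nat \oo _ (partial ^~ t) _ _ _ (product_cvg nE)).
have f1 j : nc (factor j t) <= 1 by rewrite normc_factor.
exists K => // M /= KM.
apply: le_trans (prod_tail_le (c := fun j => eps j) f1 KM _) (sum_eps_le _ _).
by move=> j /andP[Kj _]; apply: (factor_far1 nE); exact: leq_trans Kj.
Qed.

(** * Boundedness and measurability of the product *)

Lemma Re_partial K t : `|complex.Re (partial K t)| <= 1.
Proof. by rewrite -(normc_partial K t) normc_geRe. Qed.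

Lemma Im_partial K t : `|complex.Im (partial K t)| <= 1.
Proof. by rewrite -(normc_partial K t) normc_geIm. Qed.

Lemma limn_sup_bounded (u : nat -> R) (M : R) : (forall j, `|u j| <= M) -> `|limn_sup u| <= M.
Proof.
move=> uM.
have uM' j : - M <= u j <= M by rewrite -ler_norml.
have ub : has_ubound (range u) by exists M => _ [j _ <-]; have /andP[] := uM' j.
have lb : has_lbound (range u) by exists (- M) => _ [j _ <-]; have /andP[] := uM' j.
have -> : limn_sup u = inf (range (sups u)) by apply/cvg_lim => //; exact: cvg_sups_inf.
have sM j : - M <= sups u j <= M.
  apply/andP; split.
    apply: (@le_trans _ _ (u j)); first by have /andP[] := uM' j.
    by apply: ub_le_sup; [exact: has_ubound_sdrop|exists j => /=].
  apply: ge_sup; first by exists (u j), j => /=.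
  by move=> _ [i _ <-]; have /andP[] := uM' i.
rewrite ler_norml; apply/andP; split.
  apply: lb_le_inf; first by exists (sups u 0), 0%N.
  by move=> _ [j _ <-]; have /andP[] := sM j.
apply: (@le_trans _ _ (sups u 0%N)); last by have /andP[] := sM 0%N.
by apply: ge_inf; [exists (- M) => _ [j _ <-]; have /andP[] := sM j|exists 0%N].
Qed.

Lemma normc_product t : nc (product t) <= 2.
Proof.
apply: le_trans (normc_ReIm _) _; rewrite -[2]/(1 + 1) lerD//=.
  by apply: limn_sup_bounded => K; exact: Re_partial.
by apply: limn_sup_bounded => K; exact: Im_partial.
Qed.

Lemma lipschitz_measurable (f : R -> R) (M : R) :
  (forall t t', `|f t - f t'| <= M * `|t - t'|) -> leb_measurable_fun f.
Proof.
move=> H; apply: continuous_leb_measurable => t.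
apply/cvgrPdist_le => e e0.
have M1 : 0 < `|M| + 1 by rewrite ltr_wpDl.
have d0 : 0 < e / (`|M| + 1) by rewrite divr_gt0.
near=> t'.
apply: le_trans (H _ _) _.
have : `|t - t'| <= e / (`|M| + 1) by near: t'; exact: cvgr_dist_le.
rewrite ler_pdivlMr// => h; apply: le_trans h; rewrite mulrC ler_wpM2l//.
by apply: le_trans (ler_norm _) _; rewrite lerDl.
Unshelve. all: by end_near. Qed.

Lemma measurable_Re_product : leb_measurable_fun (fun t => complex.Re (product t)).
Proof.
apply: (measurable_fun_limn_sup (h := fun K (t : L) => complex.Re (partial K t))).
- by move=> t _; exists 1 => _ [K _ <-]; apply: le_trans (ler_norm _) (Re_partial _ _).
- by move=> t _; exists (- 1) => _ [K _ <-]; have := Re_partial K t; rewrite ler_norml => /andP[].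
- move=> K; apply: (@lipschitz_measurable _ (lip (S K))) => t t'.
  by rewrite -ReB (le_trans (normc_geRe _))// partial_lip.
Qed.

Lemma measurable_Im_product : leb_measurable_fun (fun t => complex.Im (product t)).
Proof.
apply: (measurable_fun_limn_sup (h := fun K (t : L) => complex.Im (partial K t))).
- by move=> t _; exists 1 => _ [K _ <-]; apply: le_trans (ler_norm _) (Im_partial _ _).
- by move=> t _; exists (- 1) => _ [K _ <-]; have := Im_partial K t; rewrite ler_norml => /andP[].
- move=> K; apply: (@lipschitz_measurable _ (lip (S K))) => t t'.
  by rewrite -ImB (le_trans (normc_geIm _))// partial_lip.
Qed.

(** The exceptional sets are measured in one period, while [boundary_function] asks for a null set
    of the line; countably many translates of the period bridge the gap. *)
Lemma leb_periodic_null (N : set R) : measurable (N : set L) ->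
  (forall t, N (t + 2 * pi) = N t) -> leb R (circle `&` N) = 0%E -> leb R N = 0%E.
Proof.
move=> mN pN N0; have pp := @twopi_gt0 R.
have key c : leb R (N `&` [set` `[c, (c + 2 * pi)%R[]) = 0%E.
  have mI := @leb_measurable_itv R.
  have mN1 : measurable_fun [set: L] (EFin \o (\1_N : L -> R)).
    by apply/measurable_EFinP; exact: measurable_indic.
  have pN1 t : (0 <= (\1_N t)%:E :> \bar R)%E by rewrite lee_fin indicE ler0n.
  have perN (t : R) : (\1_N (t + 2 * pi))%:E = (\1_N t)%:E :> \bar R.
    by congr EFin; apply: indic_eqP; exact: pN.
  have := @integral_periodic R (2 * pi) _ pp mN1 pN1 perN c.
  rewrite !integral_indic//.
  by move=> ->; rewrite -circleE (setIC N); exact: N0.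
have neg c : (leb R).-negligible (N `&` [set` `[c, (c + 2 * pi)%R[]).
  apply/negligibleP; last exact: key.
  by apply: measurableI => //; exact: leb_measurable_itv.
apply/(@negligibleP _ _ _ (leb R) N mN).
pose F (m : nat) : set L := (N `&` [set` `[(2 * pi * m%:R), (2 * pi * m%:R + 2 * pi)%R[]) `|`
  (N `&` [set` `[(- (2 * pi * m.+1%:R)), (- (2 * pi * m.+1%:R) + 2 * pi)%R[]).
apply: (@negligibleS _ _ _ (leb R) (\bigcup_m F m)); last first.
  by apply: negligible_bigcup => m; apply: negligibleU; exact: neg.
move=> t Nt.
have := floor_itv (t / (2 * pi)); rewrite intrD mulr1z ler_pdivlMr// ltr_pdivrMr//.
case: (Num.floor _) => m /andP[h1 h2].
  exists m => //; left; split => //=; rewrite in_itv/=.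
  move: h1 h2; rewrite -[(Posz m)%:~R]/(m%:R) => h1 h2; apply/andP; lra.
exists m => //; right; split => //=; rewrite in_itv/=.
by move: h1 h2; rewrite NegzE intrN => h1 h2; apply/andP; lra.
Qed.

Lemma exceptional_null : leb R (\bigcap_k exceptional k) = 0%E.
Proof.
have mN : measurable (\bigcap_k exceptional k : set L).
  by apply: bigcap_measurable => // k _; exact: exceptional_measurable.
apply: leb_periodic_null => //.
  by move=> t; apply/propeqP; split => h k _; have := h k Logic.I; rewrite exceptional_periodic.
apply/eqP; rewrite eq_le measure_ge0 andbT; apply/lee_addgt0Pr => e e0; rewrite add0e.
have [b0 _] := Svalid 0%N.
pose k := Num.truncn (budget (S 0%N) / e).
apply: le_trans (_ : (leb R (circle `&` exceptional k) <= _)%E).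
  by apply: le_outer_measure => t [ct h]; split => //; exact: h.
apply: le_trans (ltW (leb_exceptional k)) _; rewrite lee_fin.
have := budget_geometric 0 k.+1; rewrite add0n => /le_trans; apply.
rewrite ler_pdivrMr ?exprn_gt0// mulrC -ler_pdivrMr//.
apply: (@le_trans _ _ k.+1%:R); first exact: ltW (truncnS_gt _).
by rewrite -natrX ler_nat ltnW// ltn_expl.
Qed.

(** * Radial limits *)

Lemma radial_partial K t (e : R) : 0 < e -> \forall s \near (1 : R)^'-,
  nc (\prod_(0 <= j < K) moebius (rho j) ((s ^+ n j)%:C * expi ((n j)%:R * t)) - partial K t) < e.
Proof.
have s01 : \forall s \near (1 : R)^'-, 0 < s < 1.
  by near=> s; apply/andP; split; near: s; [exact: nbhs_left_gt|exact: nbhs_left_lt].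
elim: K e => [|K IH] e e0.
  by near=> s; rewrite /partial !big_geq// subrr normc0E.
have e2 : 0 < e / 2 by rewrite divr_gt0.
have /andP[r0 r1] := rho01 K.
have d0 : 0 < e / 2 * (1 - rho K) / 2 by rewrite divr_gt0// mulr_gt0// subr_gt0.
have sn : \forall s \near (1 : R)^'-, `|1 - s ^+ n K| < e / 2 * (1 - rho K) / 2.
  have c1 : s ^+ n K @[s --> (1 : R)^'-] --> (1 : R).
    rewrite -[X in _ --> X](expr1n _ (n K)).
    by apply: cvg_at_left_filter; exact: exprn_continuous.
  by move/cvgrPdist_lt : c1 => /(_ _ d0).
near=> s.
have /andP[s0 s1] : 0 < s < 1 by near: s.
have sK j : nc ((s ^+ n j)%:C * expi ((n j)%:R * t)) <= 1.
  rewrite normcME normc_expi mulr1 normc_real ger0_norm ?exprn_ge0 ?(ltW s0)//.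
  by rewrite exprn_ile1// ltW.
rewrite /partial !big_nat_recr//=.
apply: le_lt_trans (normcB_mul _ _ _ _) _.
- apply: normc_prod_le1 => j _; have /andP[? ?] := rho01 j.
  by apply: normc_moebius_le1 => //; exact: ltW.
- by rewrite normc_factor.
rewrite [e]splitr ltrD//; first by near: s; exact: IH.
rewrite -(@ltr_pM2r _ (1 - rho K)) ?subr_gt0//.
have := @moebius_lip _ (rho K) ((s ^+ n K)%:C * expi ((n K)%:R * t)) (expi ((n K)%:R * t)) (ltW
    r0) r1 (sK K).
rewrite normc_expi lexx => /(_ isT) /le_lt_trans; apply.
have -> : (s ^+ n K)%:C * expi ((n K)%:R * t) - expi ((n K)%:R * t) =
    (s ^+ n K - 1)%:C * expi ((n K)%:R * t).
  by rewrite rmorphB rmorph1 mulrBl mul1r.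
rewrite normcME normc_expi mulr1 normc_real distrC.
have : `|1 - s ^+ n K| < e / 2 * (1 - rho K) / 2 by near: s.
lra.
Unshelve. all: by end_near. Qed.

(** Two limits are interchanged through a fixed partial product: truncation after K factors costs 2
    eps K both on the circle and, uniformly in s, on the radius. *)
Lemma product_boundary (b : C -> C) :
  (forall z, nc z < 1 ->
    ((fun K => \prod_(0 <= j < K) moebius (rho j) (z ^+ n j)) : nat -> R[i]^o)
      @ \oo --> (b z : R[i]^o)) -> boundary_function b product.
Proof.
move=> bP; exists (\bigcap_k exceptional k); split.
- by apply: bigcap_measurable => // k _; exact: exceptional_measurable.
- exact: exceptional_null.
move=> t; apply: contra_notP => /existsNP[k /not_implyP[_ nE]].
apply/cvg_normcP => e e0.
pose K := (maxn k.+1 (Num.truncn (8 / e)).+1).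
have kK : (k < K)%N by rewrite leq_max leqnn.
(* Two truncations and one comparison of finite products, each costing at most e / 4. *)
have eK : 2 * eps K <= e / 4.
  have : 8 / e < 2 ^+ K.
    apply: lt_le_trans (truncnS_gt _) _; rewrite -natrX ler_nat.
    by apply: (@leq_trans K); [rewrite leq_max leqnn orbT|rewrite ltnW// ltn_expl].
  rewrite ltr_pdivrMr// exprVn => h.
  have : 2 ^- K * 8 <= 2 ^- K * (2 ^+ K * e).
    by rewrite ler_wpM2l ?invr_ge0 ?exprn_ge0// ltW.
  rewrite mulrA mulVf ?expf_neq0// mul1r; lra.
have e4 : 0 < e / 4 by rewrite divr_gt0.
near=> s.
have /andP[s0 s1] : 0 < s < 1.
  by apply/andP; split; near: s; [exact: nbhs_left_gt|exact: nbhs_left_lt].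
set z := s%:C * _.
have zE j : z ^+ n j = (s ^+ n j)%:C * expi ((n j)%:R * t).
  by rewrite exprMn rmorphXn/= -expiX.
have z1 : nc z < 1.
  by rewrite normcME [X in _ * X](normc_expi t) mulr1 normc_real gtr0_norm.
pose P M := \prod_(0 <= j < M) moebius (rho j) (z ^+ n j).
have f1 j : nc (moebius (rho j) (z ^+ n j)) <= 1.
  have /andP[? ?] := rho01 j; apply: normc_moebius_le1 => //; first exact: ltW.
  by rewrite normcXE exprn_ile1// ?normc_ge0// ltW.
have bK : nc (b z - P K) <= 2 * eps K.
  apply: (@cvg_normc_le R nat \oo _ _ _ _ _ (bP z z1)); exists K => // M /= KM.
  apply: le_trans (prod_tail_le (c := fun j => eps j) f1 KM _) (sum_eps_le _ _).
  move=> j /andP[Kj _]; rewrite zE; apply: factor_far.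
    by move=> h; apply: nE; exists j => //; exact: leq_trans Kj.
  by rewrite exprn_ge0 ?(ltW s0)//= exprn_ile1// ltW.
have PK : nc (P K - partial K t) < e / 4.
  rewrite /P; under eq_bigr do rewrite zE.
  by near: s; exact: radial_partial.
have GK : nc (product t - partial K t) <= 2 * eps K by exact: product_tail nE kK.
have -> : b z - product t = (b z - P K) + ((P K - partial K t) + (partial K t - product t)) by
    ring.
apply: le_lt_trans (normcD _ _) _.
have := normcD (P K - partial K t) (partial K t - product t).
rewrite [nc (partial K t - product t)]normcB; lra.
Unshelve. all: by end_near. Qed.

(** * Averages of the product near a point *)

Lemma cos_ge_near (a u : R) : 0 < a < pi -> cos a <= cos u ->
  exists z : int, `|u - z%:~R * (2 * pi)| <= a.
Proof.
move=> /andP[a0 ap] cu; have pp := @twopi_gt0 R.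
have := floor_itv (u / (2 * pi)); rewrite intrD mulr1z ler_pdivlMr// ltr_pdivrMr//.
set z := Num.floor _ => /andP[h1 h2]; pose v := u - z%:~R * (2 * pi).
have cv : cos v = cos u.
  have := congr1 (fun w : R[i] => complex.Re w) (expi_periodic v z).
  by rewrite /expi/= /v subrK.
rewrite -cv in cu.
have [v0 v1] : 0 <= v /\ v < 2 * pi by rewrite /v; split; lra.
have [va|va] := leP v a; first by exists z; rewrite -/v ger0_norm.
have [va'|va'] := leP (2 * pi - a) v.
  exists (z + 1); rewrite intrD mulr1z.
  have -> : u - (z%:~R + 1) * (2 * pi) = v - 2 * pi by rewrite /v; ring.
  by rewrite ler_norml; apply/andP; lra.
exfalso; move: cu; apply/negP; rewrite -ltNge.
have [vp|vp] := leP v pi.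
  by rewrite ltr_cos ?in_itv//=; lra.
have -> : cos v = cos (2 * pi - v).
  by rewrite mulr_natl [RHS]cosB cos2pi sin2pi mul1r mul0r addr0.
by rewrite ltr_cos ?in_itv//=; lra.
Qed.

(** Off the exceptional set the tail costs 2 [eps k.+1], that is [eps k]; on it the trivial bound is
    2 + 1. Inside the window the k-th factor and the variation of the partial product cost [eps k]
    each; outside it the trivial bound is 1 + 1. *)
Lemma pointwise_near k (x y a : R) (sigma : C) t : nc sigma = 1 -> 0 < a < pi ->
  (forall t, `|y - t| <= a -> nc (factor k t - sigma) <= eps k) ->
  (forall t, `|y - t| <= a -> `|x - t| <= 7 * pi / (n k)%:R) ->
  lip (S k) * (7 * pi / (n k)%:R) <= eps k ->
  nc (product t - sigma * partial k x) <=
    3 * eps k + 3 * \1_(exceptional k) t + 2 * \1_[set u | cos u < cos a] (y - t).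
Proof.
move=> s1 a01 fs xt lk; have e0 : 0 < eps k := eps_gt0 k.
have B1 : nc (product t - partial k.+1 t) <= eps k + 3 * \1_(exceptional k) t.
  rewrite indicE; have [h|h] := boolP (t \in exceptional k).
    apply: le_trans (normcD _ _) _; rewrite normcNE normc_partial.
    by have := normc_product t; rewrite mulr1; lra.
  rewrite mulr0 addr0; apply: le_trans (product_tail _ (ltnSn k)) _.
    by move=> h'; move/negP: h; apply; exact: mem_set.
  by rewrite exprS mulrA divff// mul1r.
have B2 : nc (partial k.+1 t - sigma * partial k x) <=
    2 * eps k + 2 * \1_[set u | cos u < cos a] (y - t).
  rewrite indicE; have [h|h] := boolP (y - t \in _).
    apply: le_trans (normcD _ _) _; rewrite normcNE normcME s1 !normc_partial.
    by rewrite !mulr1; lra.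
  have ca : cos a <= cos (y - t).
    by rewrite leNgt; apply/negP => h'; move/negP: h; apply; exact: mem_set.
  have [z hz] := cos_ge_near a01 ca.
  rewrite -(partial_periodic_int k.+1 t z).
  have hz' : `|y - (t + z%:~R * (2 * pi))| <= a by rewrite opprD addrA.
  rewrite mulr0 addr0 /partial big_nat_recr//= mulrC.
  apply: le_trans (normcB_mul _ _ _ _) _.
  - by rewrite normc_factor.
  - by rewrite normc_partial.
  rewrite [leRHS]mulr_natl [leRHS]mulr2n lerD//; first exact: fs.
  apply: le_trans (partial_lip _ _ _) _; apply: le_trans lk; apply: ler_wpM2l.
    by have [] := Svalid k.
  by rewrite distrC; exact: xt.
have -> : product t - sigma * partial k x =
  (product t - partial k.+1 t) + (partial k.+1 t - sigma * partial k x) by ring.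
by apply: le_trans (normcD _ _) _; lra.
Qed.

(** The real and the imaginary part are averages for the density g(y - t), each with error 8 eps
    k. *)
Lemma Phi_near k (g : R -> R) (x y a : R) (sigma : C) :
  leb_measurable_fun g -> periodic g (2 * pi) -> (forall t, 0 <= g t) ->
  (\int[leb R]_(t in circle) (g t)%:E = 1)%E ->
  ((1 - eps k)%:E <= \int[leb R]_(t in [set` `[(- a)%R, a%R]]) (g t)%:E)%E ->
  (forall e : set L, measurable e -> e `<=` circle -> (leb R e < (budget (S k.+1))%:E)%E ->
    (\int[leb R]_(t in e) (g t)%:E < (eps k)%:E)%E) ->
  nc sigma = 1 -> 0 < a < pi ->
  (forall t, `|y - t| <= a -> nc (factor k t - sigma) <= eps k) ->
  (forall t, `|y - t| <= a -> `|x - t| <= 7 * pi / (n k)%:R) ->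
  lip (S k) * (7 * pi / (n k)%:R) <= eps k ->
  nc (Phi g y product - sigma * partial k x) <= 16 * eps k.
Proof.
move=> mg pg g0 g1 conc small s1 a01 fs xt lk.
have pw t := pointwise_near t s1 a01 fs xt lk.
set c := sigma * partial k x in pw *.
have pp := @twopi_gt0 R.
have mgE : measurable_fun [set: L] (EFin \o (g : L -> R)) by apply/measurable_EFinP.
have gE0 (t : L) : (0 <= (g t)%:E)%E by rewrite lee_fin.
have pgE (t : R) : (g (t + 2 * pi))%:E = (g t)%:E by rewrite pg.
have i1 : (\int[leb R]_(t in circle) (g (y - t))%:E = 1)%E.
  by rewrite -g1 circleE (integral_periodic_reflect pp mgE gE0 pgE).
have mr : measurable_fun setT ((fun t : R => y - t)%R : L -> L) by exact: measurable_reflect.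
have mgy : measurable_fun [set: L] ((fun t : R => g (y - t)%R) : L -> R).
  exact: (measurableT_comp (mg : measurable_fun [set: L] (g : L -> R)) mr).
have K : (\int[leb R]_(t in circle) (g (y - t) * (3 * eps k + 3 * \1_(exceptional k) t +
     2 * \1_[set u | (cos u < cos a)%R] (y - t)))%:E <= (8 * eps k)%:E)%E.
  apply: (@integral_kernel_le R g y a (eps k) (exceptional k) mg pg g0 g1).
  - exact: exceptional_measurable.
  - exact: exceptional_periodic.
  - exact: ltW (eps_gt0 k).
  - exact: a01.
  - exact: conc.
  - by move=> e me ec eE; apply/ltW/small => //; rewrite eE leb_exceptional.
have mC := @measurable_circle R.
have mM : measurable_fun [set: L] (fun t : L => 3 * eps k + 3 * \1_(exceptional k) t +
     2 * \1_[set u : R | (cos u < cos a)%R] (y - t) : R).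
  have mind (A : set R) : measurable (A : set L) -> measurable_fun [set: L] (\1_A : L -> R).
    by move=> mA; exact: measurable_indic.
  have mcos : measurable ([set u : R | (cos u < cos a)%R] : set L).
    have := continuous_leb_measurable (@continuous_cos R).
    move=> /(_ measurableT [set` `]-oo, (cos a)%R[] (measurable_itv _)); rewrite setTI.
    by congr (measurable _); apply/seteqP; split => t /=; rewrite in_itv.
  apply: measurable_funD; first apply: measurable_funD; first exact: measurable_cst.
    by apply: measurable_funM; [exact: measurable_cst|apply: mind; exact: exceptional_measurable].
  apply: measurable_funM; first exact: measurable_cst.
  exact: (measurableT_comp (mind _ mcos) mr).
have part (f : L -> R) (v : R) : measurable_fun [set: L] f -> (forall t, `|f t| <= 2) ->
    (forall t, `|f t - v| <= nc (product t - c)) ->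
    `|\int[leb R]_(t in circle) (g (y - t) * f t) - v| <= 8 * eps k.
  move=> mf f2 fv.
  apply: (Rintegral_average_near mC mgy mf (fun t => g0 _) i1 f2).
  have mfv : measurable_fun [set: L] (fun t : L => `|f t - v|).
    apply: (measurableT_comp (@normr_measurable R setT)).
    by apply: measurable_funB; [exact: mf|exact: measurable_cst].
  have mL : measurable_fun (circle : set L) (fun t : L => (g (y - t) * `|f t - v|)%:E).
    by apply/measurable_EFinP/measurable_funTS/measurable_funM; [exact: mgy|exact: mfv].
  have mR : measurable_fun (circle : set L) (fun t : L => (g (y - t) * (3 * eps k +
      3 * \1_(exceptional k) t + 2 * \1_[set u | (cos u < cos a)%R] (y - t)))%:E).
    by apply/measurable_EFinP/measurable_funTS/measurable_funM; [exact: mgy|exact: mM].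
  apply: le_trans K; apply: (ge0_le_integral (leb R) mC _ mL mR).
  - by move=> t _; rewrite lee_fin mulr_ge0.
  - by move=> t _; rewrite lee_fin ler_wpM2l// (le_trans (fv t)).
have ReM (u : R) (z : C) : complex.Re (u%:C * z) = u * complex.Re z.
  by case: z => p q /=; rewrite mul0r subr0.
have ImM (u : R) (z : C) : complex.Im (u%:C * z) = u * complex.Im z.
  by case: z => p q /=; rewrite mul0r addr0.
have R1 : `|complex.Re (Phi g y product - c)| <= 8 * eps k.
  rewrite ReB.
  have -> : complex.Re (Phi g y product) =
      \int[leb R]_(t in circle) (g (y - t) * complex.Re (product t)).
    by apply: eq_Rintegral => t _; rewrite ReM.
  apply: part; first exact: measurable_Re_product.
  - by move=> t; apply: le_trans (normc_geRe _) (normc_product _).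
  - by move=> t; rewrite -ReB normc_geRe.
have I1 : `|complex.Im (Phi g y product - c)| <= 8 * eps k.
  rewrite ImB.
  have -> : complex.Im (Phi g y product) =
      \int[leb R]_(t in circle) (g (y - t) * complex.Im (product t)).
    by apply: eq_Rintegral => t _; rewrite ImM.
  apply: part; first exact: measurable_Im_product.
  - by move=> t; apply: le_trans (normc_geIm _) (normc_product _).
  - by move=> t; rewrite -ImB normc_geIm.
by apply: le_trans (normc_ReIm _) _; lra.
Qed.

(** It is the phase n y that is zero modulo 2 pi: y is the angle of a root of unity, where the
    factor equals -1. Over the window [moebius_near] and [expi_lip] leave an error of eps k / 2. *)
Lemma factor_near_zero k (y t : R) (z : int) : (n k)%:R * y = z%:~R * (2 * pi) ->
  `|y - t| <= (1 - rho k) * eps k / 8 / (n k)%:R -> nc (factor k t - (- 1)) <= eps k.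
Proof.
move=> ny yt; have /andP[r0 r1] := rho01 k; have [n0 _ _ _ _] := Sgood k.
have nR : 0 < (n k)%:R :> R by rewrite ltr0n.
rewrite opprK addrC -(@ler_pM2r _ (1 - rho k)) ?subr_gt0//.
have w1 : nc (expi ((n k)%:R * t)) <= 1 by rewrite normc_expi.
apply: le_trans (moebius_near (ltW r0) r1 w1) _.
have -> : 1 = expi ((n k)%:R * y) by rewrite ny -[X in expi X]add0r expi_periodic expi0.
have := expi_lip ((n k)%:R * y) ((n k)%:R * t).
rewrite -mulrBr normrM normr_nat.
move: yt; rewrite ler_pdivlMr// => yt h.
have e0 : 0 < eps k := eps_gt0 k.
have : 0 <= (1 - rho k) * eps k by apply: mulr_ge0; [rewrite subr_ge0 ltW|exact: ltW].
lra.
Qed.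

(** At phase pi the window is far from the roots of unity: there cos(n t) <= 0 <= cos(width), since
    |v| and the width are at most 1 <= pi / 2, and [factor_far] applies. *)
Lemma factor_near_antipode k (y t : R) (z : int) : (n k)%:R * y = pi + z%:~R * (2 * pi) ->
  `|y - t| <= (1 - rho k) * eps k / 8 / (n k)%:R -> nc (factor k t - 1) <= eps k.
Proof.
move=> ny yt; have /andP[r0 r1] := rho01 k; have [n0 _ _ /andP[w0 w1] _] := Sgood k.
have nR : 0 < (n k)%:R :> R by rewrite ltr0n.
have e0 : 0 < eps k := eps_gt0 k; have e1 : eps k <= 1 := eps_le1 k; have pi2 := @pi_ge2 R.
have u1 : (1 - rho k) * eps k <= 1.
  by apply: mulr_ile1; [rewrite subr_ge0 ltW|exact: ltW|rewrite gerBl ltW|exact: e1].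
move: yt; rewrite ler_pdivlMr// -[X in _ * X](normr_nat R) -normrM => yt.
pose v := (y - t) * (n k)%:R.
have v1 : `|v| <= 1 by apply: le_trans yt _; lra.
have ct : cos ((n k)%:R * t) = - cos v.
  have -> : (n k)%:R * t = (pi - v) + z%:~R * (2 * pi).
    by rewrite /v mulrBl [y * _]mulrC ny; ring.
  have := congr1 (fun w : R[i] => complex.Re w) (expi_periodic (pi - v) z).
  by rewrite /expi/= => ->; rewrite cosB cospi sinpi mul0r addr0 mulN1r.
rewrite normcB; have := @factor_far k t 1; rewrite mul1r ler01 lexx; apply => //.
rewrite ct; apply/negP; rewrite -leNgt.
have cv : 0 <= cos v.
  by apply: cos_ge0_pihalf; move: v1; rewrite ler_norml => /andP[? ?]; apply/andP; lra.
have cw : 0 <= cos (width (S k.+1)) by apply: cos_ge0_pihalf; apply/andP; lra.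
lra.
Qed.

End product.

Theorem theorem1p3 (R : realType) (phi : R -> R -> R) (lambda : R -> R)
  (phi_periodic : forall r, 0 < r < 1 -> periodic (phi r) (2 * pi))
  (phi_measurable : forall r, 0 < r < 1 -> leb_measurable_fun (phi r))
  (phi_ge0 : forall r, 0 < r < 1 -> forall t, 0 <= phi r t)
  (phi_int1 : forall r, 0 < r < 1 ->
    (\int[leb R]_(t in circle) (phi r t)%:E = 1)%E)
  (phi_equi : forall eps tau : R, 0 < eps -> 0 < tau < 1 ->
    exists2 delta : R, 0 < delta &
      forall r, 0 < r < tau ->
      forall e : set (lebType R), measurable e -> e `<=` circle ->
        (leb R e < delta%:E)%E -> (\int[leb R]_(t in e) (phi r t)%:E < eps%:E)%E)
  (lambda_cont : {within `[0, 1], continuous lambda})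
  (lambda1 : lambda 1 = 0)
  (phi_lambda :
    limf_esup (fun delta : R =>
      limf_einf (fun r : R =>
        (oriented_integral (phi r) (- (delta * lambda r)) (delta * lambda r))%:E)
        (1 : R)^'-)
      (0 : R)^'+ = 1%:E) :
  exists B : R -> R[i],
    [/\ Linfty_circle B,
        exists2 b : R[i] -> R[i], blaschke_product b & boundary_function b B &
        forall x : R,
          ~ exists l : R[i],
            (Phi (phi r) (x + lambda r) B : R[i]^o) @[r --> (1 : R)^'-]
              --> (l : R[i]^o)].
Proof.
(* Choice over all pairs gives a total successor map; validity is a premise, propagated by
   induction. *)
have /choice[f fP] : forall ks : nat * stage R, exists s', valid ks.2 ->
    valid s' /\ next phi lambda ks.1 ks.2 s'.
  move=> [k s] /=; have [vs|nvs] := pselect (valid s); last by exists s.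
  have [s' v' n'] := next_exists phi_measurable phi_ge0 phi_equi lambda_cont lambda1 phi_lambda
      k vs.
  by exists s'.
(* The initial stage stands for the empty product, with Lipschitz constant 0 and budget 1. *)
pose s0 : stage R := Stage 1 (2^-1) 1 (2^-1) 1 0.
pose S := fix S k := if k is k'.+1 then f (k', S k') else s0.
have Sv k : valid (S k).
  elim: k => [|k IH]; first by split; rewrite /=.
  by have [] := fP (k, S k) IH.
have Sn k : next phi lambda k (S k) (S k.+1) by have [] := fP (k, S k) (Sv k).
have S0 : lip (S 0%N) = 0 by [].
have Sgood k : good_factor k (S k.+1) by have [] := Sn k.
have Swidth k : 4 * width (S k.+1) <= budget (S k) / 4 by have [_ _ _ []] := Sn k.
have Sbudget k : budget (S k.+1) <= budget (S k) / 2 by have [_ _ _ []] := Sn k.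
have Slip k : lip (S k.+1) = lip (S k) + 4 * (order (S k.+1))%:R / (1 - radius (S k.+1)).
  by have [_ _ _ []] := Sn k.
clearbody S; clear fP f s0.
exists (product S); split.
- split.
  + exact: product_periodic.
  + exact: measurable_Re_product.
  + exact: measurable_Im_product.
  apply: (@le_lt_trans _ _ 2%:E); last exact: ltry.
  by apply/ess_supP; apply: aeW => t; rewrite lee_fin normc_normC /=; exact: normc_product.
- have [j|j|j|b bB bP] := @blaschke_product_exists R (fun k => order (S k.+1)) (fun k => radius
    (S k.+1)).
  + by have [] := Sgood j.
  + by have [] := Sgood j.
  + by have [] := Sgood j.
  by exists b => //; exact: product_boundary Sgood Sv Swidth Sbudget _ bP.
move=> x [l /cvg_normcP lP].
have e1 : (0 : R) < 1 / 4 by rewrite divr_gt0.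
have [a0 /andP[a00 a01] Ha] := near_at_left_exists (@ltr01 R) (lP _ e1).
have pi0 := @pi_gt0 R; have pi2 := @pi_ge2 R.
(* The first bound puts every r > 1 - eps k where Phi is within 1/4 of l; the second makes 16 eps k
   <= 1/8, and 1/4 + 1/8 < 1/2. *)
have [k k1 k2] : exists2 k, 2^-1 ^+ k <= 1 - a0 & (2^-1 : R) ^+ k <= 1 / 128.
  pose d := Num.min (1 - a0) (1 / 128).
  have d0 : 0 < d by rewrite lt_min divr_gt0// subr_gt0 a01.
  have [k kd] : exists k, (2^-1 : R) ^+ k <= d.
    pose k := (Num.truncn (1 / d)).+1; exists k.
    have : 1 / d < 2 ^+ k.
      apply: lt_le_trans (truncnS_gt _) _; rewrite -natrX ler_nat.
      by apply: ltnW; exact: ltn_expl.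
    rewrite ltr_pdivrMr// exprVn => h.
    by rewrite -[leLHS]mulr1 -[leRHS](mulKf (x := 2 ^+ k)) ?expf_neq0// ler_pM2l ?invr_gt0
        ?exprn_gt0// ltW.
  by exists k; apply: le_trans kd _; rewrite ge_min lexx ?orbT.
have [[n0 /andP[r0 r1] _ _ _] neg reach [_ _ _ lk]] := Sn k.
set N : R := (order (S k.+1))%:R in reach lk *.
have N0 : 0 < N by rewrite ltr0n.
have e0 : 0 < (2^-1 : R) ^+ k := eps_gt0 k.
have e1' : (2^-1 : R) ^+ k <= 1 := eps_le1 k.
pose a := (1 - radius (S k.+1)) * 2^-1 ^+ k / 8 / N.
have u1 : (1 - radius (S k.+1)) * 2^-1 ^+ k <= 1.
  by apply: mulr_ile1; [rewrite subr_ge0 ltW|exact: ltW|rewrite gerBl ltW|exact: e1'].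
have u0 : 0 < (1 - radius (S k.+1)) * 2^-1 ^+ k by rewrite mulr_gt0// subr_gt0.
have aN : a <= 1 / N.
  by rewrite /a ler_pM2r ?invr_gt0//; move: u1; clear; lra.
have a0' : 0 < a by rewrite /a !divr_gt0.
have N1 : 1 <= N by rewrite ler1n.
have aa : 0 < a < pi.
  rewrite a0'; apply: le_lt_trans aN (le_lt_trans _ (lt_le_trans (ltr1n R 2) pi2)).
  by rewrite ler_pdivrMr// mul1r.
(* The target point m / N is x + lambda(r); m is its phase and sigma the approximate value of the
   k-th factor around it. *)
have key (m : R) (sigma : R[i]) : 2 * pi <= m - N * x <= 5 * pi ->
    ComplexField.Normc.normc sigma = 1 ->
    (forall t, `|m / N - t| <= a ->
       ComplexField.Normc.normc (factor S k t - sigma) <= 2^-1 ^+ k) ->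
    ComplexField.Normc.normc (l - sigma * partial S k x) < 1 / 2.
  move=> /andP[m1 m2] s1 fs.
  have xE : x + (m - N * x) / N = m / N by field; rewrite gt_eqF.
  have [|r [/andP[rk r1'] rt rl conc]] := reach ((m - N * x) / N).
    by rewrite !ler_pM2r ?invr_gt0// m1.
  have r01 : 0 < r < 1 by case/andP: rt => rt0 _; rewrite rt0.
  have lr : ComplexField.Normc.normc (Phi (phi r) (x + lambda r) (product S) - l) < 1 / 4.
    by apply: Ha; rewrite r1' andbT; move: k1 rk; clear; lra.
  have := @Phi_near R S S0 Sgood Sv Swidth Sbudget Slip k (phi r) x (m / N) a sigma
    (phi_measurable _ r01) (phi_periodic _ r01) (phi_ge0 _ r01) (phi_int1 _ r01) conc
    (neg r rt) s1 aa fs _ lk.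
  rewrite rl xE in lr * => /(_ _) h.
  have {}h : ComplexField.Normc.normc (Phi (phi r) (m / N) (product S) - sigma * partial S k x)
      <= 16 * 2^-1 ^+ k.
    apply: h => t ht.
    have -> : x - t = (x - m / N) + (m / N - t) by ring.
    apply: le_trans (ler_normD _ _) _.
    have -> : x - m / N = - ((m - N * x) / N) by field; rewrite gt_eqF.
    rewrite normrN ger0_norm; last first.
      by apply: divr_ge0; [move: pi0 m1; clear; lra|exact: ltW].
    have h5 : (m - N * x) / N <= 5 * pi / N by rewrite ler_pM2r ?invr_gt0.
    have h7 : 7 * pi / N = 5 * pi / N + 2 * pi / N by ring.
    have h2 : 1 / N <= 2 * pi / N by rewrite ler_pM2r ?invr_gt0//; move: pi2; clear; lra.
    by rewrite h7 lerD// (le_trans ht)// (le_trans aN).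
  have -> : l - sigma * partial S k x = (l - Phi (phi r) (m / N) (product S)) +
    (Phi (phi r) (m / N) (product S) - sigma * partial S k x) by ring.
  apply: le_lt_trans (normcD _ _) _; rewrite normcB.
  by move: lr h k2; clear; lra.
(* With 2 pi j <= N x < 2 pi (j + 1), the phase 2 pi (j + 2) lies between 2 pi and 4 pi beyond N x,
   and the antipode after it between 3 pi and 5 pi. *)
have := floor_itv (N * x / (2 * pi)).
rewrite intrD mulr1z ler_pdivlMr ?mulr_gt0// ltr_pdivrMr ?mulr_gt0//.
set j := Num.floor _ => /andP[j1 j2].
have j2E : (j + 2)%:~R = j%:~R + 2 :> R by rewrite intrD.
have neg1 : ComplexField.Normc.normc (l - (- 1) * partial S k x) < 1 / 2.
  apply: (key ((j + 2)%:~R * (2 * pi))).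
  - by rewrite j2E; apply/andP; move: j1 j2 pi0; clear; lra.
  - by rewrite normcNE normc1E.
  - move=> t; apply: (factor_near_zero Sgood (z := (j + 2))).
    by rewrite mulrC divfK// gt_eqF.
have pos1 : ComplexField.Normc.normc (l - 1 * partial S k x) < 1 / 2.
  apply: (key (pi + (j + 2)%:~R * (2 * pi))).
  - by rewrite j2E; apply/andP; move: j1 j2 pi0; clear; lra.
  - exact: normc1E.
  - move=> t; apply: (factor_near_antipode Sgood (z := (j + 2))).
    by rewrite mulrC divfK// gt_eqF.
have P1 := normc_partial Sgood k x.
(* The unimodular number P(x) would satisfy 2 |P(x)| < 1/2 + 1/2. *)
have : ComplexField.Normc.normc ((2 : R)%:C%C * partial S k x) = 2.
  by rewrite normcME P1 mulr1 normc_real gtr0_norm.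
have -> : (2 : R)%:C%C * partial S k x = (l - (- 1) * partial S k x) - (l - 1 * partial S k x).
  have -> : (2 : R)%:C%C = 2 by rewrite rmorph_nat.
  by ring.
have := normcD (l - (- 1) * partial S k x) (- (l - 1 * partial S k x)).
rewrite normcNE; move: neg1 pos1; clear; lra.
Qed.
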